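(* Let $\ell\geq 4$, $t\geq 3$ and $q_1,q_2\geq 1$ be integers, and let $q=q_1+q_2$. Then there exist a safe $\{1,\dots,q_1\}$-determiner and a safe $\{q_1+1,\dots,q\}$-determiner for $\mathcal{T}(q_1,q_2,\ell,t)$.
   Context: All graphs are finite and simple; a $q$-coloring is a coloring of edges with colors in $[q]$. $\mathcal{T}(q_1,q_2,\ell,t)=(H_1,\dots,H_q)$ is the tuple with $H_i=C_\ell$ (cycle on $\ell$ vertices) for $i\le q_1$ and $H_i=K_t$ for $q_1<i\le q$. A $q$-coloring $\phi$ of a graph is $(H_1,\dots,H_q)$-free if for every $i\in[q]$ the graph formed by the edges of color $i$ contains no copy of $H_i$. For a graph $F$, $A\subseteq E(F)$ and an $(H_1,\dots,H_q)$-free $q$-coloring $\phi$ of $F$, $\phi$ is safe at $A$ if for every graph $G$ with $V(F)\cap V(G)\subseteq V(A)$ (the set of endpoints of edges in $A$), a $q$-coloring $\psi$ of $F\cup G$ with $\psi|_F=\phi$ is $(H_1,\dots,H_q)$-free if and only if $\psi|_G$ is $(H_1,\dots,H_q)$-free. For $X\subseteq[q]$, an $X$-determiner for $(H_1,\dots,H_q)$ is a graph $D$ with a distinguished edge $d$ (the signal edge) such that: (D1) $D$ has an $(H_1,\dots,H_q)$-free $q$-coloring; (D2) every $(H_1,\dots,H_q)$-free $q$-coloring $\phi$ of $D$ has $\phi(d)\in X$; (D3) for every $c\in X$ there is an $(H_1,\dots,H_q)$-free $q$-coloring $\phi$ of $D$ with $\phi(d)=c$. The determiner is safe if for every $c\in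 X$ the coloring in (D3) can be chosen to be safe at $\{d\}$.
   Formalization: In the definition of ''safe at A'', G ranges only over graphs that contain every edge of A both of whose endpoints lie in V(G); without this, a monochromatic path on ℓ vertices joining the ends of d shows that no coloring is safe at {d}. *)

(* Defs.v *)
From mathcomp Require Import all_boot.
From mathcomp Require Import finmap.

Set Implicit Arguments.
Unset Strict Implicit.
Unset Printing Implicit Defensive.

Local Open Scope fset_scope.

(* Finite simple graphs, all with vertices in the infinite universe nat, so
   that two graphs may share vertices and edges; an edge is a two-element set
   of vertices. *)
Definition graph_axiom (V : {fset nat}) (E : {fset {fset nat}}) : Prop :=
  forall e, e \in E -> e `<=` V /\ #|` e| = 2.

Record graph : Type := Graph {
  verts : {fset nat};
  edges : {fset {fset nat}};
  graphP : graph_axiom verts edges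
}.

Lemma rel_graph_axiom (V : {fset nat}) (r : rel nat) :
  graph_axiom V [fset [fset p.1; p.2] | p in V `*` V
                                      & (p.1 != p.2) && r p.1 p.2].
Proof.
move=> e /imfsetP[[x y] /=]; rewrite !inE /= => /andP[/andP[xV yV] /andP[xy _]] ->.
by rewrite cardfs2 xy; split=> //; apply/fsubsetP=> z; rewrite !inE => /orP[]/eqP->.
Qed.

(* x and y are adjacent when x != y and r x y or r y x. *)
Definition rel_graph (V : {fset nat}) (r : rel nat) : graph :=
  Graph (@rel_graph_axiom V r).

Definition vertex_range (n : nat) : {fset nat} := [fset i | i in iota 0 n].

Definition cycle_graph (l : nat) : graph :=
  rel_graph (vertex_range l) (fun i j => j == i.+1 %% l).

Definition complete_graph (t : nat) : graph :=
  rel_graph (vertex_range t) (fun _ _ => true).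

Lemma gunion_axiom (F G : graph) :
  graph_axiom (verts F `|` verts G) (edges F `|` edges G).
Proof.
move=> e; rewrite inE => /orP[] /graphP[sub ->]; split=> //.
  exact: fsubset_trans sub (fsubsetUl _ _).
exact: fsubset_trans sub (fsubsetUr _ _).
Qed.

Definition gunion (F G : graph) : graph := Graph (@gunion_axiom F G).

Definition contains_copy (F H : graph) : Prop :=
  exists f : nat -> nat,
    [/\ {in verts H &, injective f},
        {in verts H, forall x, f x \in verts F}
      & {in edges H, forall e, [fset f x | x in e] \in edges F}].

(* Colorings are total functions on vertex sets; only the values on the edges
   of the graph under consideration matter. Hence the restriction of a coloring
   to a subgraph is the same function, and "psi extends phi" is agreement on
   edges. The colors 1, ..., q are represented by 0, ..., q-1. *)
Definition coloring (q : nat) : Type := {fset nat} -> 'I_q.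

Lemma color_graph_axiom q (F : graph) (phi : coloring q) (i : 'I_q) :
  graph_axiom (verts F) [fset e in edges F | phi e == i].
Proof. by move=> e; rewrite !inE => /andP[/graphP]. Qed.

Definition color_graph q (F : graph) (phi : coloring q) (i : 'I_q) : graph :=
  Graph (@color_graph_axiom q F phi i).

Definition free_coloring q (H : 'I_q -> graph) (F : graph) (phi : coloring q) :
    Prop :=
  forall i, ~ contains_copy (color_graph F phi i) (H i).

Definition endpoints (A : {fset {fset nat}}) : {fset nat} :=
  \bigcup_(e <- A) e.

(* Meant for A `<=` edges F and phi a free coloring of F. F and G are glued
   along A: an edge of A with both ends in G is an edge of G. Without this
   proviso no free coloring is safe at an edge d when H (phi d) is a cycle or
   a clique with at least 3 vertices: take for G a copy of H (phi d) minus an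
   edge whose ends are those of d, all in color phi d. *)
Definition safe_at q (H : 'I_q -> graph) (F : graph) (A : {fset {fset nat}})
    (phi : coloring q) : Prop :=
  forall G : graph,
    verts F `&` verts G `<=` endpoints A ->
    {in A, forall e, e `<=` verts G -> e \in edges G} ->
    forall psi : coloring q, {in edges F, psi =1 phi} ->
      free_coloring H (gunion F G) psi <-> free_coloring H G psi.

Definition determiner q (H : 'I_q -> graph) (X : {set 'I_q})
    (D : graph) (d : {fset nat}) : Prop :=
  [/\ d \in edges D,
      exists phi : coloring q, free_coloring H D phi,
      forall phi : coloring q, free_coloring H D phi -> phi d \in X
    & forall c, c \in X ->
        exists phi : coloring q, free_coloring H D phi /\ phi d = c].

Definition safe_determiner q (H : 'I_q -> graph) (X : {set 'I_q})
    (D : graph) (d : {fset nat}) : Prop :=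
  determiner H X D d /\
  forall c, c \in X ->
    exists phi : coloring q,
      [/\ free_coloring H D phi, phi d = c & safe_at H D [fset d] phi].

Definition cycle_clique_tuple (q1 q2 l t : nat) (i : 'I_(q1 + q2)) : graph :=
  if i < q1 then cycle_graph l else complete_graph t.
Arguments cycle_clique_tuple : clear implicits.

(* Main.v *)
Require Import Defs.
From mathcomp Require Import all_boot.
From mathcomp Require Import finmap.
From mathcomp Require Import zify.
From Stdlib Require Import Classical.

Set Implicit Arguments.
Unset Strict Implicit.
Unset Printing Implicit Defensive.

(* A graph minimal with respect to having no free colouring, minus one edge, gives a
   rooted block: recolouring the missing edge shows that in every free colouring its
   root meets every cycle colour. Gluing blocks along hypergraphs of large girth and
   large chromatic number (built by partite amalgamation as by Nesetril and Rodl)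
   creates no new short cycle and no new clique, and produces gadgets whose terminals
   are pairwise at distance e, yet in every free colouring two of them are joined by a
   path of length e in a prescribed cycle colour. Identify the terminals of gadgets of
   length l - 2 with vertices that a common hub sees in a given cycle colour: if all
   identifications are made, a monochromatic C_l appears, so some identification is
   critical. The edge from the hub to the critical vertex must then have a cycle
   colour, for otherwise distances would allow the identification.

   Attach next such edges as spokes from a new hub to the terminals of a gadget, up to
   a critical spoke. Replacing that spoke by a plain edge forces it to have a clique
   colour. All other paths between its ends have length at least l - 1, so the edge
   stays safe in any graph glued along it. Finally, in a graph that is critical for
   colourings with clique colours only, force every edge in this safe way: the critical
   missing edge must have a cycle colour, and again there is no short way around it. *)

(** * Closed walks in hypergraphs *)

(** Nothing is known about short paths inside a block, and the first edges forced to a cycle colour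
    lie inside blocks, so they need not be safe. Hence the detour through clique colours, where the
    forced edge is a bare edge with only long ways round it. Distances are certified by potentials,
    functions to [nat] that change by at most one along edges: they can be defined piece by piece
    and survive gluing. The length [l - 2] is what two further edges from a hub complete to [C_l].
    Cliques contain triangles, so they only see distances up to 3 (merging two vertices) or 2
    (adding an edge); this is one use of [l >= 4]. Which vertex a root or hub sees in a given colour
    depends on the colouring. So gadgets are attached for every possible neighbour, and a hypergraph
    of large chromatic number, coloured by this neighbour, provides a hyperedge on which the choice
    is the same throughout. *)

Lemma cycle_defect (T : eqType) (e : rel T) (s : seq T) :
  uniq s -> 1 < size s -> ~~ cycle e s ->
  exists n x y p, rot n s = [:: x, y & p] /\ ~~ e x y.
Proof.
move=> us s1 nc.
have [x xs ne] : exists2 x, x \in s & ~~ e x (next s x).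
  apply/hasP; rewrite has_predC; apply/negP => /allP ea.
  by move/negP: nc; apply; apply: cycle_from_next.
have [n p Ep] := rot_to xs.
have up : uniq (x :: p) by rewrite -Ep rot_uniq.
case: p => [|y p] in Ep up; first by move: s1; rewrite -(size_rot n) Ep.
exists n, x, y, p; split=> //.
by move: ne; rewrite -(next_rot n us) Ep /= eqxx.
Qed.

Section Compress.
Variables (T A : eqType).
Implicit Type s : seq (T * (A * nat)).

Variable link : A -> nat -> T -> T -> bool.
Hypothesis link_trans : forall a w w' x y z,
  link a w x y -> link a w' y z -> link a (w + w') x z.

Let linked (p q : T * (A * nat)) := link p.2.1 p.2.2 p.1 q.1.

(** Neighbouring entries with equal labels are merged and their weights added, until neighbours
    differ or one label is left. The weight counts the steps of the original walk that a merged
    entry stands for. *)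
Lemma compress_cycle s :
  0 < size s -> uniq (map fst s) -> cycle linked s ->
  (exists a, all (fun p => p.2.1 == a) s) \/
  exists s', [/\ cycle linked s', cycle (fun p q => p.2.1 != q.2.1) s',
                 uniq (map fst s'), 1 < size s' <= size s
               & sumn (map (snd \o snd) s') = sumn (map (snd \o snd) s)].
Proof.
move En: (size s) => n; elim: n s En => // n IHn s En _ us cs.
case: n => [|n] in IHn En *.
  by case: s En {us cs} => [|p []] // _; left; exists p.2.1; rewrite /= eqxx.
have us' : uniq s := map_uniq us.
case nes: (cycle (fun p q => p.2.1 != q.2.1) s).
  by right; exists s; rewrite cs nes us En /=.
have [|k [p [p' [r [Er /negPn/eqP Epp']]]]] := cycle_defect us' _ (negbT nes).
  by rewrite En.
have Sr : size (rot k s) = n.+2 by rewrite size_rot.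
have ur : uniq (map fst (rot k s)) by rewrite map_rot rot_uniq.
have cr : cycle linked (rot k s) by rewrite rot_cycle.
have sr : sumn (map (snd \o snd) (rot k s)) = sumn (map (snd \o snd) s).
  by apply: perm_sumn; rewrite map_rot perm_rot.
move: Sr ur cr sr; rewrite Er /= => -[Sr] ur cr sr.
set s1 := (p.1, (p.2.1, p.2.2 + p'.2.2)) :: r.
have u1 : uniq (map fst s1).
  by move: ur; rewrite /= inE negb_or -andbA => /and4P[_ -> _ ->].
have c1 : cycle linked s1.
  case/andP: cr => lpp'.
  rewrite /s1 /=; case: (r) => [|p2 r'] /=; rewrite /linked /= ?andbT.
    by rewrite -Epp' => l2; apply: link_trans lpp' l2.
  case/andP=> l2; rewrite rcons_path => /andP[pr lr].
  rewrite rcons_path pr lr !andbT.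
  by apply: link_trans lpp' _; rewrite Epp'.
have [] := IHn s1 _ _ u1 c1; rewrite /s1 /= ?Sr //.
  case=> a /andP[pa ra]; left; exists a.
  have : all (fun p0 => p0.2.1 == a) (rot k s) by rewrite Er /= -Epp' pa.
  by rewrite (perm_all _ (_ : perm_eq (rot k s) s)) // perm_rot.
case=> s' [cs' ns' us'' /andP[z1 z2] ss']; right; exists s'; split=> //.
  by rewrite z1 (leq_trans z2).
by rewrite ss' -sr addnA.
Qed.

End Compress.

Definition no_short_cycle (T A : eqType) (V : A -> pred T) (g : nat) : Prop :=
  forall s : seq (T * A), 1 < size s <= g -> uniq (map fst s) ->
    cycle (fun p q => V p.2 p.1 && V p.2 q.1) s ->
    cycle (fun p q => p.2 != q.2) s -> False.

Lemma no_short_cycle_leq (T A : eqType) (V : A -> pred T) g g' :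
  g' <= g -> no_short_cycle V g -> no_short_cycle V g'.
Proof. by move=> le H s /andP[s1 s2]; apply: H; rewrite s1 (leq_trans s2). Qed.

Lemma not_uniq_split (T U : eqType) (f : U -> T) (s : seq U) :
  ~~ uniq (map f s) ->
  exists s1 s2 s3 a b, s = s1 ++ a :: s2 ++ b :: s3 /\ f a = f b.
Proof.
elim: s => //= x s IHs; rewrite negb_and negbK => /orP[/mapP[y ys fxy]|/IHs].
  have [s1 s2] := path.splitPr ys.
  by exists [::], s1, s2, x, y.
by case=> [s1 [s2 [s3 [a [b [-> E]]]]]]; exists (x :: s1), s2, s3, a, b.
Qed.

Section NoReturn.
Variables (T A : eqType) (V : A -> pred T) (g : nat).
Hypothesis V_girth : no_short_cycle V g.

Let link (p q : T * A) := [&& V p.2 p.1, V p.2 q.1, p.1 != q.1 & p.2 != q.2].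

(* A closed walk without backtracking contains a cycle: the part between two visits of
   the same vertex is a shorter closed walk. *)
Lemma no_closed_walk e s :
  path link e s -> V (last e s).2 (last e s).1 -> V (last e s).2 e.1 ->
  (last e s).1 != e.1 -> size s < g -> False.
Proof.
move En: (size s) => n; elim/ltn_ind: n e s En => n IHn e s En ps Vll Vle nle ng.
case us: (uniq (map fst (e :: s))); last first.
  have [s1 [s2 [s3 [a [b [Es Eab]]]]]] := not_uniq_split (negbT us).
  have pa : path link a (s2 ++ b :: s3) /\ (size (s2 ++ b :: s3) <= n).
    case: s1 Es => [[<- <-]|c s1 [_ Es]]; first by rewrite En.
    move: ps; rewrite Es cat_path /= => /and3P[_ _ ->]; split=> //.
    by rewrite -En Es !size_cat /= !size_cat /=; lia.
  case: pa; rewrite cat_path /= size_cat /= => /and3P[p2 lb _] sz.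
  case/and4P: lb => V1 V2 nb _.
  have lt2 : size s2 < n by apply: leq_trans sz; rewrite addnS ltnS leq_addr.
  by apply: (IHn (size s2) lt2 a s2); rewrite // ?Eab // (ltn_trans lt2).
have s0 : 0 < size s by case: (s) nle => //=; rewrite eqxx.
have W x p : path link x p -> path (fun p q => V p.2 p.1 && V p.2 q.1) x p.
  by apply: sub_path => {}p q /and4P[-> ->].
have N x p : path link x p -> path (fun p q => p.2 != q.2) x p.
  by apply: sub_path => {}p q /and4P[].
(* If the closing hyperedge is also the first one, the first entry is dropped: that hyperedge
   contains the second vertex too, so the shorter walk still closes up. *)
case: (eqVneq (last e s).2 e.2) => [E2|N2]; last first.
  apply: (V_girth (s := e :: s) _ us).
  - by rewrite /= ltnS s0 En.
  - by rewrite /= rcons_path W //= Vll Vle.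
  - by rewrite /= rcons_path N.
case: s => [|e1 s] //= in En ps Vll Vle nle us s0 E2 *.
case/andP: ps => /and4P[V1 V2 n1 n2] ps.
case: s => [|e2 s] in En ps Vll Vle nle us s0 E2 *.
  by rewrite /= E2 eqxx in n2.
apply: (V_girth (s := e1 :: e2 :: s)).
- by move: (ltnW ng); rewrite -En.
- by case/andP: us.
- by move: (W _ _ ps) => /= /andP[-> b]; rewrite rcons_path b Vll E2 V2.
- by move: (N _ _ ps) => /= /andP[-> b]; rewrite rcons_path b E2.
Qed.

End NoReturn.

(** * Hypergraphs of large girth and chromatic number *)

Definition on_edge (V A N : finType) (inc : A -> N -> V) : A -> pred V :=
  fun a x => [exists k, inc a k == x].

(** A hyperedge is an injection of [N] rather than a vertex set, so that graphs can be attached at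
    named positions. Arbitrary finite types [C] are allowed because the colours will record local
    data of an edge colouring. *)
Definition chromatic_girth (g : nat) : Prop :=
  forall N C : finType, 0 < #|C| ->
  exists (V A : finType) (inc : A -> N -> V),
    [/\ forall a, injective (inc a), no_short_cycle (on_edge inc) g
      & forall f : V -> C, exists a, forall k k', f (inc a k) = f (inc a k')].

Lemma map_preimage (T : eqType) (U : Type) (h : U -> T) (s : seq T) :
  (forall x, x \in s -> exists u, x = h u) -> exists s', s = map h s'.
Proof.
elim: s => [|x s IHs] H; first by exists [::].
have [u ->] := H x (mem_head _ _).
have [|s' ->] := IHs; last by exists (u :: s').
by move=> y ys; apply: H; rewrite inE ys orbT.
Qed.

Lemma uniq_map_inj (T U : eqType) (f : T -> U) (s : seq T) :
  uniq (map f s) -> {in s &, injective f}.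
Proof.
elim: s => //= x s IHs /andP[nx us] a b; rewrite !inE.
case/predU1P=> [->|as_] /predU1P[->|bs] // E; last exact: IHs.
  by case/negP: nx; rewrite E map_f.
by case/negP: nx; rewrite -E map_f.
Qed.

Section Amalgam.
Variables (g : nat) (N C P : finType) (V A : finType) (pi : V -> P) (inc : A -> N -> V).
Variables (V1 A1 : finType) (inc1 : A1 -> V -> V1) (i : P).

(** Partite amalgamation: one copy of the hypergraph on [V] for every hyperedge [b] of [inc1].
    Distinct copies can meet only in part [i], which is laid out along [inc1 b]. *)
Definition am_emb (b : A1) (v : V) : V1 + A1 * V :=
  if pi v == i then inl (inc1 b v) else inr (b, v).

Definition am_pi (x : V1 + A1 * V) : P := if x is inr (_, v) then pi v else i.

Definition am_inc (ba : A1 * A) (k : N) := am_emb ba.1 (inc ba.2 k).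

Lemma am_pi_emb b v : am_pi (am_emb b v) = pi v.
Proof. by rewrite /am_emb; case: eqP. Qed.

Hypothesis part : forall a, injective (pi \o inc a).
Hypothesis inc1_inj : forall b, injective (inc1 b).

Lemma am_emb_inj b : injective (am_emb b).
Proof.
move=> v v'; rewrite /am_emb.
by case: (pi v == i); case: (pi v' == i) => // -[E]; rewrite // (inc1_inj E).
Qed.

Hypothesis girth1 : no_short_cycle (on_edge inc1) g.
Hypothesis girth : no_short_cycle (on_edge inc) g.*2.+1.

Let isl (x : V1 + A1 * V) := if x is inl _ then true else false.
Let link b w (x y : V1 + A1 * V) :=
  [&& on_edge am_emb b x, on_edge am_emb b y, 0 < w
    & (1 < w) || ~~ [&& isl x, isl y & x != y]].

(** A cycle inside one copy is a cycle of [inc]. Otherwise it changes copies only in part [i]; as a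
    hyperedge meets that part at most once, every visit to a copy takes at least two steps. So a
    cycle of length at most [2g + 1] makes at most [g] visits, and these form a short cycle of
    [inc1]. *)
Lemma am_girth : no_short_cycle (on_edge am_inc) g.*2.+1.
Proof.
move=> s /andP[s1 s2] us cs ns.
pose s0 := [seq (p.1, (p.2.1, 1)) | p <- s].
have l0 : cycle (fun p q => link p.2.1 p.2.2 p.1 q.1) s0.
  rewrite /s0 cycle_map; apply: sub_cycle cs => -[x [b a]] [y [b' a']] /=.
  case/andP=> /existsP[/= k /eqP<-] /existsP[/= k' /eqP <-].
  rewrite /link /=; apply/and3P; split.
  - by apply/existsP; exists (inc a k).
  - by apply/existsP; exists (inc a k').
  apply/negP; rewrite /am_inc /am_emb /=.
  case: eqP => //= E1; case: eqP => //= E2.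
  by rewrite (part (etrans E1 (esym E2))) eqxx.
have us0 : uniq (map fst s0) by rewrite /s0 -map_comp.
have [||[b ab]|[s' [cs' ns' us' /andP[z1 z2] ss']]] := compress_cycle _ _ us0 l0.
- move=> b w w' x y z /and4P[h1 _ h2 _] /and4P[_ h3 h4 _].
  by rewrite /link h1 h3 /=; lia.
- by rewrite size_map ltnW.
- have [s'' Es] : exists s'', s = [seq (am_emb b q.1, (b, q.2)) | q <- s''].
    apply: map_preimage => -[x [b' a]] ps.
    have Eb : b' = b by apply/eqP/(allP ab (x, (b', 1))); apply/mapP; exists (x, (b', a)).
    have := next_cycle cs ps => /andP[/existsP[k /eqP/= Ex] _].
    by exists (inc a k, a); rewrite -Ex Eb.
  rewrite Es size_map in s1 s2; rewrite Es -map_comp in us.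
  rewrite Es !cycle_map in cs ns.
  apply: (girth (s := s'')).
  - by rewrite s1.
  - by apply: (@map_uniq _ _ (am_emb b)); rewrite -map_comp.
  - apply: sub_cycle cs => -[v a] [v' a'] /= /andP[/existsP[k /eqP h] /existsP[k' /eqP h']].
    by apply/andP; split; apply/existsP; [exists k | exists k'];
      apply/eqP/(@am_emb_inj b).
  - by apply: sub_cycle ns => -[v a] [v' a'] /=; rewrite xpair_eqE eqxx.
have all_l p : p \in s' -> isl p.1.
  move=> ps; have us1 := map_uniq us'.
  have p's : prev s' p \in s' by rewrite mem_prev.
  have := prev_cycle cs' ps => /and4P[_ /existsP[v /eqP h1] _ _].
  have := next_cycle cs' ps => /and4P[/existsP[v' /eqP h2] _ _ _].
  have := prev_cycle ns' ps; rewrite -h2 in h1 *.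
  by move: h1; rewrite /am_emb; case: (pi v == i); case: (pi v' == i) => -[] // -> _; rewrite eqxx.
have w2 p : p \in s' -> 1 < p.2.2.
  move=> ps; have := next_cycle cs' ps => /and4P[_ _ _ /orP[//|]].
  rewrite !all_l ?mem_next //= negbK => /eqP E.
  have us1 := map_uniq us'.
  have : next s' p = p.
    have inj := uniq_map_inj us'.
    by apply: inj => //; rewrite mem_next.
  by move=> Ep; have := next_cycle ns' ps; rewrite Ep eqxx.
have sw : sumn (map (snd \o snd) s0) = size s.
  by rewrite /s0 -map_comp; elim: (s) => //= p r ->.
have szs' : size s' <= g.
  have : (size s').*2 <= size s.
    rewrite -sw -ss'; elim: (s') w2 => //= p r IHr w2.
    rewrite doubleS -addn2 addnC leq_add ?w2 ?mem_head // IHr // => x xr.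
    by rewrite w2 // inE xr orbT.
  by move: s2; lia.
have [s'' Es] : exists s'', s' = [seq (inl q.1, q.2) | q <- s''].
  apply: map_preimage => -[[v|y] bw] ps; first by exists (v, bw).
  by have := all_l _ ps.
rewrite Es size_map in z1 szs'; rewrite Es -map_comp in us'.
rewrite Es !cycle_map in cs' ns'.
apply: (girth1 (s := [seq (q.1, q.2.1) | q <- s''])).
- by rewrite size_map z1.
- rewrite -map_comp; apply: (@map_uniq _ _ (inl : V1 -> V1 + A1 * V)).
  by rewrite -map_comp.
- rewrite cycle_map; apply: sub_cycle cs' => -[v [b w]] [v' [b' w']] /=.
  case/and4P => /existsP[u /eqP h] /existsP[u' /eqP h'] _ _.
  apply/andP; split; apply/existsP.
    by exists u; move: h; rewrite /am_emb; case: eqP => // _ [->].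
  by exists u'; move: h'; rewrite /am_emb; case: eqP => // _ [->].
- by rewrite cycle_map.
Qed.

End Amalgam.

(* Every placement of N into the parts is realised by an edge on which, over the parts
   already treated, the colour depends on the part only. *)
Definition part_ramsey (N C P V A : finType) (pi : V -> P) (inc : A -> N -> V)
    (ps : seq P) : Prop :=
  forall f : V -> C, exists c : P -> C, forall J : N -> P, injective J ->
    exists a, (forall k, pi (inc a k) = J k) /\
              (forall k, J k \in ps -> f (inc a k) = c (J k)).

(** Start from disjoint hyperedges, one for each placement. To treat part [i], amalgamate over a
    hypergraph whose hyperedges are indexed by all of [V]: some copy has part [i] monochromatic, and
    the induction hypothesis is applied to the colouring of that copy. *)
Lemma part_ramsey_exists (g : nat) (N C P : finType) (ps : seq P) :
  chromatic_girth g -> 0 < #|C| ->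
  exists (V A : finType) (pi : V -> P) (inc : A -> N -> V),
    [/\ forall a, injective (pi \o inc a), no_short_cycle (on_edge inc) g.*2.+1
      & part_ramsey C pi inc ps].
Proof.
move=> Hg C0; elim: ps => [|i ps [V [A [pi [inc [Hpart Hgirth HR]]]]]].
  pose A : finType := {J : {ffun N -> P} | injectiveb J}.
  exists (A * N)%type, A, (fun x : A * N => (val x.1 : {ffun N -> P}) x.2), (fun a k => (a, k)).
  split.
  - by move=> a k k' /= /(injectiveP _ (valP a)).
  - move=> s /andP[s1 _] _ cs ns; move: s1.
    case: s cs ns => [|p [|p' s]] //= /andP[/andP[_ /existsP[k /eqP E1]] cs] /andP[/eqP np _] _.
    apply: np; move: E1; case: s cs => [|p'' s] /= /andP[/andP[/existsP[k' /eqP <-] _] _];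
      by case.
  - move=> f; have [c0 _] := card_gt0P C0; exists (fun=> c0) => J inj.
    have injb : injectiveb (finfun J) by apply/injectiveP => x y; rewrite !ffunE => /inj.
    by exists (exist (fun h : {ffun N -> P} => injectiveb h) _ injb); split=> k //=; rewrite ffunE.
have [V1 [A1 [inc1 [inj1 girth1 mono1]]]] := Hg V C C0.
exists (V1 + A1 * V)%type, (A1 * A)%type, (am_pi pi i), (am_inc pi inc inc1 i); split.
- by move=> [b a] k k' /=; rewrite !am_pi_emb => /Hpart.
- exact: am_girth.
move=> f; have [b bP] := mono1 (f \o inl).
have [c cP] := HR (f \o am_emb pi inc1 i b).
(* The colour of part [i] is read off at any of its vertices; if the part is empty the value is
   arbitrary. *)
exists (fun p => if p == i then
   (if [pick v | pi v == i] is Some v then f (inl (inc1 b v)) else c p) else c p) => J inj.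
have [a [a1 a2]] := cP J inj; exists (b, a); split=> k.
  by rewrite am_pi_emb a1.
rewrite inE; case: eqP => [Ek _|_ /=]; last exact: a2.
rewrite /am_inc /am_emb /= a1 Ek eqxx; case: pickP => [v _|/(_ (inc a k))].
  exact: bP.
by rewrite a1 Ek eqxx.
Qed.

Lemma card_fiber_ge (T C : finType) (n : nat) (f : T -> C) :
  #|C| * n < #|T| -> exists c, n < #|[pred x | f x == c]|.
Proof.
move=> lt; apply: NNPP => H; move: lt; rewrite ltnNge => /negP; apply.
rewrite -(eq_card (_ : [pred x : T | true] =i T)) //.
rewrite -sum1_card (partition_big f predT) //=.
rewrite -sum_nat_const; apply: leq_sum => c _.
rewrite sum1_card leqNgt; apply/negP => h; apply: H; exists c.
by apply: leq_trans h (eq_leq (eq_card _)) => x; rewrite !inE.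
Qed.

Lemma injection_into (N T : finType) (D : pred T) :
  #|N| <= #|D| -> exists2 J : N -> T, injective J & forall k, D (J k).
Proof.
move=> le; exists (fun k => enum_val (widen_ord le (enum_rank k))).
  by move=> k k' /enum_val_inj/(congr1 val)/= /val_inj/enum_rank_inj.
by move=> k; apply: (enum_valP (widen_ord le (enum_rank k))).
Qed.

(** With [#|C| * #|N| + 1] parts, all of them treated, pigeonhole finds enough parts of one colour
    to place a monochromatic hyperedge. Amalgamation turns [g] into [2g + 1], which covers [g + 1];
    the induction starts with all injections into a large set. *)
Theorem chromatic_girth_all (g : nat) : chromatic_girth g.
Proof.
elim: g => [|g IHg] N C C0.
  pose V : finType := 'I_(#|C| * #|N|).+1.
  pose A : finType := {J : {ffun N -> V} | injectiveb J}.
  exists V, A, (fun a : A => (val a : {ffun N -> V})); split.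
  - by move=> a; apply/injectiveP; apply: valP a.
  - by move=> s /andP[s1 s2]; have := leq_trans s1 s2.
  move=> f; have [c lt] : exists c, #|N| < #|[pred x | f x == c]|.
    by apply: card_fiber_ge; rewrite card_ord.
  have [J inj JD] := injection_into (ltnW lt).
  have injb : injectiveb (finfun J) by apply/injectiveP => x y; rewrite !ffunE => /inj.
  by exists (exist (fun h : {ffun N -> V} => injectiveb h) _ injb) => k k' /=; rewrite !ffunE (eqP (JD k)) (eqP (JD k')).
pose P : finType := 'I_(#|C| * #|N|).+1.
have [V [A [pi [inc [Hpart Hgirth HR]]]]] := part_ramsey_exists N (enum P) IHg C0.
exists V, A, inc; split.
- by move=> a k k' E; apply: (Hpart a); rewrite /= E.
- by apply: no_short_cycle_leq Hgirth; rewrite -addnn; lia.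
move=> f; have [c cP] := HR f.
have [c0 lt] : exists c0, #|N| < #|[pred x | c x == c0]| by apply: card_fiber_ge; rewrite card_ord.
have [J inj JD] := injection_into (ltnW lt).
have [a [_ a2]] := cP J inj; exists a => k k'.
by rewrite !a2 ?mem_enum // (eqP (JD k)) (eqP (JD k')).
Qed.

(** * Gluing along hypergraphs *)

Definition has_cycle (l : nat) (T : eqType) (R : rel T) : Prop :=
  exists s, [/\ size s = l, uniq s & cycle R s].

Definition has_clique (t : nat) (T : eqType) (R : rel T) : Prop :=
  exists s, [/\ size s = t, uniq s & pairwise R s].

Lemma has_cycle_sub l (T : eqType) (R R' : rel T) :
  subrel R R' -> has_cycle l R -> has_cycle l R'.
Proof. by move=> sub [s [? ? cs]]; exists s; split=> //; apply: sub_cycle cs. Qed.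

Lemma has_clique_sub t (T : eqType) (R R' : rel T) :
  subrel R R' -> has_clique t R -> has_clique t R'.
Proof. by move=> sub [s [? ? cs]]; exists s; split=> //; apply: sub_pairwise cs. Qed.

Lemma pairwise_in (T : eqType) (R : rel T) s :
  symmetric R -> pairwise R s -> {in s &, forall x y, x != y -> R x y}.
Proof.
move=> symR; elim: s => //= z s IHs /andP[/allP az ps] x y; rewrite !inE.
case/predU1P=> [->|xs] /predU1P[->|ys] //; last exact: IHs.
- by rewrite eqxx.
- by move=> _; apply: az.
- by move=> _; rewrite symR; apply: az.
Qed.

Lemma in_pairwise (T : eqType) (R : rel T) s :
  uniq s -> {in s &, forall x y, x != y -> R x y} -> pairwise R s.
Proof.
elim: s => //= z s IHs /andP[zs us] H; apply/andP; split; last first.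
  by apply: IHs => // x y xs ys; apply: H; rewrite inE ?xs ?ys orbT.
apply/allP => y ys; apply: H; rewrite ?inE ?eqxx ?ys ?orbT //.
by apply: contraNneq zs => ->.
Qed.

Definition img (T : finType) (U : eqType) (f : T -> U) (R : rel T) : rel U :=
  fun x y => [exists u, exists v, [&& R u v, f u == x & f v == y]].

Lemma imgP (T : finType) (U : eqType) (f : T -> U) (R : rel T) x y :
  reflect (exists u v, [/\ R u v, f u = x & f v = y]) (img f R x y).
Proof.
apply: (iffP existsP) => [[u /existsP[v /and3P[? /eqP ? /eqP ?]]]|[u [v [? <- <-]]]].
  by exists u, v.
by exists u; apply/existsP; exists v; apply/and3P.
Qed.

Lemma img_inj (T : finType) (U : eqType) (f : T -> U) (R : rel T) u v :
  injective f -> img f R (f u) (f v) -> R u v.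
Proof. by move=> inj /imgP[u' [v' [? /inj <- /inj <-]]]. Qed.

Lemma img_sym (T : finType) (U : eqType) (f : T -> U) (R : rel T) :
  symmetric R -> symmetric (img f R).
Proof.
move=> symR x y; apply/imgP/imgP => -[u [v [Ruv <- <-]]];
  by exists v, u; rewrite symR.
Qed.

Lemma has_cycle_img l (T : finType) (U : eqType) (f : T -> U) (R : rel T) :
  injective f -> has_cycle l (img f R) -> has_cycle l R.
Proof.
move=> inj [s [sz us cs]].
have [s' Es] : exists s', s = map f s'.
  by apply: map_preimage => x xs; have /imgP[u [v [_ <- _]]] := next_cycle cs xs; exists u.
move: sz us cs; rewrite Es size_map (map_inj_uniq inj) cycle_map => sz us cs.
by exists s'; split=> //; apply: sub_cycle cs => u v; apply: img_inj.
Qed.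

Lemma has_clique_img t (T : finType) (U : eqType) (f : T -> U) (R : rel T) :
  1 < t -> injective f -> has_clique t (img f R) -> has_clique t R.
Proof.
move=> t1 inj [s [sz us cs]].
have [s' Es] : exists s', s = map f s'.
  case: s sz us cs => [|x [|y s]] sz us; try by rewrite -sz in t1.
  rewrite pairwise_cons => /andP[/allP ax _]; apply: map_preimage => z; rewrite inE => /predU1P[->|zs].
    by have /imgP[u [v [_ <- _]]] := ax y (mem_head _ _); exists u.
  by have /imgP[u [v [_ _ <-]]] := ax z zs; exists v.
move: sz us cs; rewrite Es size_map (map_inj_uniq inj) pairwise_map => sz us cs.
by exists s'; split=> //; apply: sub_pairwise cs => u v; apply: img_inj.
Qed.

Section Good.
Variables (q1 q l t : nat).
Hypotheses (l3 : 2 < l) (t3 : 2 < t).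

Definition good (T : eqType) (R : 'I_q -> rel T) : Prop :=
  forall i : 'I_q, if i < q1 then ~ has_cycle l (R i) else ~ has_clique t (R i).

Lemma good_sub (T : eqType) (R R' : 'I_q -> rel T) :
  (forall i, subrel (R i) (R' i)) -> good R' -> good R.
Proof.
move=> sub H i; have := H i; case: ifP => _ h k; apply: h.
  exact: has_cycle_sub k.
exact: has_clique_sub k.
Qed.

Lemma good_hom (T U : eqType) (f : T -> U) (R : 'I_q -> rel T) (R' : 'I_q -> rel U) :
  injective f -> (forall i x y, R i x y -> R' i (f x) (f y)) -> good R' -> good R.
Proof.
move=> inj sub H i; have := H i; case: ifP => _ h [s [sz us cs]]; apply: h;
  exists (map f s); rewrite size_map (map_inj_uniq inj); split=> //.
  by rewrite cycle_map; apply: sub_cycle cs => x y; apply: sub.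
by rewrite pairwise_map; apply: sub_pairwise cs => x y; apply: sub.
Qed.

Lemma good_img (T : finType) (U : eqType) (f : T -> U) (R : 'I_q -> rel T) :
  injective f -> good R -> good (fun i => img f (R i)).
Proof.
move=> inj H i; have := H i; case: ifP => _ h k; apply: h.
  exact: has_cycle_img inj k.
by apply: has_clique_img inj k; apply: ltnW.
Qed.

Section Glue.
Variables (A : finType) (T : A -> finType) (W : finType) (io : forall a, T a -> W).
Hypothesis io_inj : forall a, injective (@io a).
Hypothesis girth : no_short_cycle (fun a x => [exists v, @io a v == x]) l.

Let tot (R : forall a, rel (T a)) : rel W := fun x y => [exists a, img (@io a) (R a) x y].

Lemma img_support (a : A) (R : rel (T a)) x y : img (@io a) R x y ->
  [exists v, @io a v == x] && [exists v, @io a v == y].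
Proof.
by case/imgP=> u [v [_ <- <-]]; apply/andP; split; apply/existsP; [exists u|exists v].
Qed.

(** Label each vertex by a piece that contains the edge to its successor. If several labels remain
    after merging equal neighbours, they form a short cycle in the hypergraph of vertex sets of
    pieces. *)
Lemma cycle_one_piece (R : forall a, rel (T a)) s :
  1 < size s <= l -> uniq s -> cycle (tot R) s -> exists a, cycle (img (@io a) (R a)) s.
Proof.
move=> /andP[s1 sl] us cs.
have [a0 _] : exists a0 : A, true.
  by case: (s) s1 cs => [|x [|y r]] //= _ /andP[/existsP[a _] _]; exists a.
pose al x := odflt a0 [pick a | img (@io a) (R a) x (next s x)].
have alP x : x \in s -> img (@io (al x)) (R (al x)) x (next s x).
  move=> xs; rewrite /al; case: pickP => //= H.
  by have /existsP[a] := next_cycle cs xs; rewrite H.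
pose s0 := [seq (x, (al x, 1)) | x <- s].
pose link a (w : nat) x y := [exists v, @io a v == x] && [exists v, @io a v == y].
have l0 : cycle (fun p q => link p.2.1 p.2.2 p.1 q.1) s0.
  by rewrite cycle_map; apply: cycle_from_next => // x /alP/img_support.
have u0 : uniq (map fst s0) by rewrite -map_comp map_id.
have [||[a ab]|[s' [cs' ns' us' /andP[z1 z2] _]]] := compress_cycle _ _ u0 l0.
- by move=> a w w' x y z /andP[h1 _] /andP[_ h2]; rewrite /link h1.
- by rewrite size_map ltnW.
- exists a; apply: cycle_from_next => // x xs; have := alP x xs.
  by have /eqP := allP ab _ (map_f (fun x => (x, (al x, 1))) xs) => /= ->.
case: (girth (s := [seq (p.1, p.2.1) | p <- s'])).
- by rewrite size_map z1 /= (leq_trans z2) // size_map.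
- by rewrite -map_comp.
- by rewrite cycle_map.
- by rewrite cycle_map.
Qed.

Lemma img_unique (R : forall a, rel (T a)) a b x y :
  x != y -> img (@io a) (R a) x y -> img (@io b) (R b) x y -> a = b.
Proof.
move=> xy /img_support/andP[h1 h2] /img_support/andP[h3 h4].
apply/eqP/negPn/negP => ab; apply: (girth (s := [:: (x, a); (y, b)])) => //=.
- exact: ltnW.
- by rewrite inE xy.
- by rewrite h1 h2 h3 h4.
- by rewrite ab eq_sym ab.
Qed.

(** A triangle is a cycle of length at most [l], hence lies in one piece, and an edge lies in only
    one piece. So all triangles on a fixed edge of the clique lie in the piece of that edge. *)
Lemma clique_one_piece (R : forall a, rel (T a)) s :
  (forall a, symmetric (R a)) -> 2 < size s -> uniq s -> pairwise (tot R) s ->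
  exists a, pairwise (img (@io a) (R a)) s.
Proof.
move=> symR s3 us cs.
have symt : symmetric (tot R).
  by move=> x y; apply/existsP/existsP => -[a h]; exists a; rewrite img_sym.
have tri x y z : uniq [:: x; y; z] -> x \in s -> y \in s -> z \in s ->
    exists a, [/\ img (@io a) (R a) x y, img (@io a) (R a) y z & img (@io a) (R a) x z].
  move=> u3 xs ys zs; have P := pairwise_in symt cs.
  have [|||a /= /and4P[h1 h2 h3 _]] := @cycle_one_piece R [:: x; y; z]; rewrite ?l3 //=.
    move: u3; rewrite /= !inE negb_or => /and3P[/andP[xy xz] yz _].
    by rewrite !P //= eq_sym.
  by exists a; split=> //; rewrite img_sym.
case: s => [|x [|y [|z r]]] // in s3 us cs tri *.
have xy : x != y by move: us; rewrite /= !inE !negb_or => /andP[/andP[]].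
have /existsP[a axy] : tot R x y by move: cs; rewrite /= => /andP[/andP[]].
have ax w : w \in [:: x, y, z & r] -> w != x -> img (@io a) (R a) x w.
  move=> ws wx; have [->//|wy] := eqVneq w y.
  have [|||//|b [h1 _ h2]] := tri x y w; last by rewrite (img_unique xy axy h1).
  - by rewrite /= !inE negb_or xy eq_sym wx eq_sym wy.
  - by rewrite !inE eqxx.
  - by rewrite !inE eqxx orbT.
exists a; apply: in_pairwise => // u v us_ vs uv.
have [Eu|ux] := eqVneq u x; first by rewrite Eu; apply: ax; rewrite // -Eu eq_sym.
have [Ev|vx] := eqVneq v x; first by rewrite Ev img_sym // ax.
have [||//|//|b [h1 h2 _]] := tri x u v.
- by rewrite /= !inE negb_or eq_sym ux eq_sym vx uv.
- by rewrite !inE eqxx.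
by rewrite (img_unique _ (ax u us_ ux) h1) // eq_sym.
Qed.

Lemma good_glue (R : forall a, 'I_q -> rel (T a)) :
  (forall a i, symmetric (R a i)) -> (forall a, good (R a)) ->
  good (fun i x y => [exists a, img (@io a) (R a i) x y]).
Proof.
move=> symR gR i; case: ifP => iq [s [sz us cs]].
  have [|//||a ca] := @cycle_one_piece (fun a => R a i) s => //.
    by rewrite sz leqnn ltnW.
  have := gR a i; rewrite iq; apply; apply: (@has_cycle_img _ _ _ (@io a)) => //.
  by exists s.
have [|||//|a ca] := @clique_one_piece (fun a => R a i) s => //.
  by rewrite sz.
have := gR a i; rewrite iq; apply; apply: (@has_clique_img _ _ _ (@io a)) => //.
  exact: ltnW.
by exists s.
Qed.

End Glue.
End Good.

(** * Multigraphs and critical graphs *)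

Lemma critical_set (T : finType) (P : {set T} -> Prop) :
  P set0 -> ~ P setT -> exists (S : {set T}) (x : T), [/\ x \notin S, P S & ~ P (x |: S)].
Proof.
move=> P0 PT; apply: NNPP => H; apply: PT.
have all_n n : forall S : {set T}, #|S| = n -> P S.
  elim: n => [|n IHn] S cS; first by rewrite (cards0_eq cS).
  have /set0Pn[x xS] : S != set0 by rewrite -card_gt0 cS.
  apply: NNPP => nS; apply: H; exists (S :\ x), x; split.
  - by rewrite !inE eqxx.
  - by apply: IHn; have := cardsD1 x S; rewrite xS cS => -[].
  - by rewrite setD1K.
exact: all_n erefl.
Qed.

Lemma next_neq (T : eqType) (s : seq T) x :
  uniq s -> 1 < size s -> x \in s -> next s x != x.
Proof.
move=> us s1 xs; have [n p Ep] := rot_to xs.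
rewrite -(next_rot n us) Ep; case: p Ep => [|y p] Ep.
  by move: s1; rewrite -(size_rot n) Ep.
rewrite /= eqxx; have : uniq (x :: y :: p) by rewrite -Ep rot_uniq.
by rewrite /= inE negb_or eq_sym => /andP[/andP[]].
Qed.

Lemma sum_count (T : Type) (q : nat) (f : T -> 'I_q) (s : seq T) :
  \sum_(i < q) count (fun y => f y == i) s = size s.
Proof.
elim: s => [|x s IHs] /=; first by rewrite big1.
rewrite big_split /= IHs (bigD1 (f x)) //= eqxx big1 ?addn0 //.
by move=> i; rewrite eq_sym => /negbTE ->.
Qed.

Lemma count_pigeonhole (T : Type) (q n : nat) (f : T -> 'I_q) (s : seq T) :
  q * n < size s -> exists i, n < count (fun y => f y == i) s.
Proof.
move=> lt; apply: NNPP => H; move: lt; rewrite ltnNge => /negP; apply.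
rewrite -(sum_count f) -[q in q * n]card_ord -sum_nat_const; apply: leq_sum => i _.
by rewrite leqNgt; apply/negP => h; apply: H; exists i.
Qed.

(** First half of Ramsey's theorem: the colour of a pair depends on its earlier vertex only and is
    stored next to that vertex. *)
Lemma end_homogeneous (q n : nat) : exists N, forall (T : eqType) (c : T -> T -> 'I_q) (s : seq T),
  uniq s -> N <= size s ->
  exists s' : seq (T * 'I_q),
    [/\ size s' = n, uniq (map fst s'), {subset map fst s' <= s}
      & pairwise (fun p p' => c p.1 p'.1 == p.2) s'].
Proof.
elim: n => [|n [N IHN]]; first by exists 0 => T c s _ _; exists [::].
exists (q * N).+2 => T c [//|x s] /= /andP[xs us]; rewrite ltnS => sz.
have [i ci] := count_pigeonhole (c x) sz.
have [||s' [z1 z2 z3 z4]] := IHN T c [seq y <- s | c x y == i].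
- exact: filter_uniq.
- by rewrite size_filter ltnW.
exists ((x, i) :: s'); split=> /=.
- by rewrite z1.
- rewrite z2 andbT; apply: contra xs => /z3; by rewrite mem_filter => /andP[].
- move=> y; rewrite !inE => /predU1P[->|/z3]; first by rewrite eqxx.
  by rewrite mem_filter => /andP[_ ->]; rewrite orbT.
rewrite z4 andbT; apply/allP => p /(map_f fst)/z3.
by rewrite mem_filter => /andP[].
Qed.

Lemma ramsey (q m : nat) : exists N, forall (T : eqType) (c : T -> T -> 'I_q) (s : seq T),
  uniq s -> N <= size s ->
  exists i s', [/\ size s' = m, uniq s' & pairwise (fun x y => c x y == i) s'].
Proof.
have [N HN] := end_homogeneous q (q * m).+1; exists N => T c s us sz.
have [s' [z1 z2 _ z4]] := HN T c s us sz.
have [i ci] : exists i, m < count (fun p => p.2 == i) s'.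
  by apply: count_pigeonhole; rewrite z1.
exists i, (take m (map fst [seq p <- s' | p.2 == i])); split.
- by rewrite size_takel // size_map size_filter ltnW.
- apply: take_uniq; apply: subseq_uniq z2; apply: map_subseq; exact: filter_subseq.
have : pairwise (fun x y => c x y == i) (map fst [seq p <- s' | p.2 == i]).
  rewrite pairwise_map; apply: (sub_in_pairwise (P := fun p => p.2 == i)); last first.
  - exact: pairwise_filter z4.
  - exact: filter_all.
  by move=> p p' /eqP <- _ /=.
by rewrite -{1}(cat_take_drop m (map fst _)) pairwise_cat => /and3P[].
Qed.

(** Edges form a type of their own, so gluing takes the disjoint union of edge types, and colourings
    of the pieces combine and restrict without side conditions. Loops are harmless, since cycles and
    cliques have distinct vertices. *)
Record mgraph : Type := MGraph {
  vt : finType;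
  et : finType;
  src : et -> vt;
  tgt : et -> vt
}.

Definition glue (A : finType) (P : A -> mgraph) (W : finType)
    (io : forall a, vt (P a) -> W) : mgraph :=
  @MGraph W {a : A & et (P a)}
    (fun e => io (tag e) (src (tagged e))) (fun e => io (tag e) (tgt (tagged e))).

Definition joins (G : mgraph) (e : et G) : rel (vt G) :=
  fun x y => (src e == x) && (tgt e == y) || (src e == y) && (tgt e == x).

Lemma joins_sym (G : mgraph) (e : et G) : symmetric (joins e).
Proof. by move=> x y; rewrite /joins orbC. Qed.

Lemma joinsP (G : mgraph) (e : et G) x y :
  reflect ((src e = x /\ tgt e = y) \/ (src e = y /\ tgt e = x)) (joins e x y).
Proof.
apply: (iffP orP) => -[].
- by case/andP=> /eqP ? /eqP ?; left.
- by case/andP=> /eqP ? /eqP ?; right.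
- by case=> -> ->; rewrite !eqxx; left.
- by case=> -> ->; rewrite !eqxx; right.
Qed.

Section Mono.
Variables (q1 q l t : nat).
Hypotheses (l3 : 2 < l) (t3 : 2 < t).
Local Notation good := (@good q1 q l t _).

Definition mono (G : mgraph) (phi : et G -> 'I_q) (i : 'I_q) : rel (vt G) :=
  fun x y => [exists e, (phi e == i) && joins e x y].

Lemma monoP (G : mgraph) (phi : et G -> 'I_q) i x y :
  reflect (exists e, phi e = i /\ joins e x y) (mono phi i x y).
Proof.
by apply: (iffP existsP) => -[e]; [case/andP=> /eqP ? ?|case=> ? ?]; exists e => //; apply/andP; split=> //; apply/eqP.
Qed.

Lemma mono_symmetric (G : mgraph) (phi : et G -> 'I_q) i : symmetric (mono phi i).
Proof. by move=> x y; apply/monoP/monoP => -[e]; rewrite joins_sym => h; exists e. Qed.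

Definition free (G : mgraph) (phi : et G -> 'I_q) : Prop := good (mono phi).

Definition colorable (G : mgraph) : Prop := exists phi : et G -> 'I_q, free phi.

Section GlueGraph.
Variables (A : finType) (P : A -> mgraph) (W : finType) (io : forall a, vt (P a) -> W).

Definition on_piece (phi : et (glue io) -> 'I_q) (a : A) : et (P a) -> 'I_q :=
  fun e => phi (Tagged (fun a => et (P a)) e).

Lemma mono_glue (phi : et (glue io) -> 'I_q) i x y :
  mono phi i x y = [exists a, img (@io a) (mono (on_piece phi (a := a)) i) x y].
Proof.
apply/monoP/existsP => [[[a e] [/= Ei /joinsP /= J]]|[a /imgP[u [v [/monoP[e [Ei J]] <- <-]]]]].
  exists a; apply/imgP.
  case: J => -[<- <-].
    by exists (src e), (tgt e); split=> //; apply/monoP; exists e; split=> //; apply/joinsP; left.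
  by exists (tgt e), (src e); split=> //; apply/monoP; exists e; split=> //; apply/joinsP; right.
exists (Tagged (fun a => et (P a)) e); split=> //; apply/joinsP.
by case/joinsP: J => -[<- <-]; [left|right].
Qed.

Lemma mono_on_piece (phi : et (glue io) -> 'I_q) a i u v :
  mono (on_piece phi (a := a)) i u v -> mono phi i (io u) (io v).
Proof. by move=> m; rewrite mono_glue; apply/existsP; exists a; apply/imgP; exists u, v. Qed.

Lemma free_on_piece (phi : et (glue io) -> 'I_q) a :
  injective (@io a) -> free phi -> free (on_piece phi (a := a)).
Proof. by move=> inj; apply: good_hom inj _ => i x y; apply: mono_on_piece. Qed.

Lemma colorable_glue :
  (forall a, injective (@io a)) ->
  no_short_cycle (fun a x => [exists v, @io a v == x]) l ->
  (forall a, colorable (P a)) -> colorable (glue io).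
Proof.
move=> inj girth colP; have [phi Hphi] := fin_all_exists colP.
exists (fun e => phi (tag e) (tagged e)); apply: good_sub (@good_glue _ _ _ _ l3 t3 _ _ _ _ inj girth (fun a => mono (phi a)) _ Hphi).
  by move=> i x y; rewrite mono_glue.
by move=> a i; apply: mono_symmetric.
Qed.

End GlueGraph.

(* An edge is deleted by turning it into a loop. *)
Definition subK (N : nat) (S : {set 'I_N * 'I_N}) : mgraph :=
  @MGraph 'I_N ('I_N * 'I_N)%type fst (fun e => if (e.1 < e.2) && (e \in S) then e.2 else e.1).

Lemma has_cycle_homogeneous m (T : eqType) (R : rel T) s :
  symmetric R -> 1 < m <= size s -> uniq s -> pairwise R s -> has_cycle m R.
Proof.
move=> symR /andP[m1 ms] us ps; exists (take m s); split.
- by rewrite size_takel.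
- exact: take_uniq.
have ut : uniq (take m s) by apply: take_uniq.
have pt : pairwise R (take m s) by move: ps; rewrite -{1}(cat_take_drop m s) pairwise_cat => /and3P[].
apply: cycle_from_next => // x xs; apply: (pairwise_in symR pt) => //.
  by rewrite mem_next.
by rewrite eq_sym next_neq // size_takel.
Qed.

Lemma subK_not_colorable : exists N, ~ colorable (subK [set: 'I_N * 'I_N]).
Proof.
have [N HN] := ramsey q (maxn l t); exists N => -[phi fphi].
pose c (x y : 'I_N) := if x < y then phi (x, y) else phi (y, x).
have [||i [s [sz us ps]]] := HN _ c (enum 'I_N); first exact: enum_uniq.
  by rewrite size_enum_ord.
have pm : pairwise (mono phi i) s.
  have symc : symmetric (fun x y => c x y == i).
    by move=> x y; rewrite /c; case: ltngtP => // /val_inj->.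
  apply: in_pairwise => // x y xs ys xy; have /eqP := pairwise_in symc ps xs ys xy.
  rewrite /c; case: ltngtP => [lt|lt|/val_inj E]; last by rewrite E eqxx in xy.
    by move=> E; apply/monoP; exists (x, y); split=> //; apply/joinsP; left=> /=; rewrite lt inE.
  by move=> E; apply/monoP; exists (y, x); split=> //; apply/joinsP; right=> /=; rewrite lt inE.
have := fphi i; case: ifP => _; apply.
  apply: has_cycle_homogeneous pm => //; first exact: mono_symmetric.
  by rewrite sz leq_max leqnn ltnW.
exists (take t s); split.
- by rewrite size_takel // sz leq_max leqnn orbT.
- exact: take_uniq.
by move: pm; rewrite -{1}(cat_take_drop t s) pairwise_cat => /and3P[].
Qed.

(** The palette [Pal] consists of all colours in [rooted_block] and of the clique colours in
    [safe_cycle_forcing]. *)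
Lemma critical_graph (Pal : pred 'I_q) (c0 : 'I_q) : Pal c0 ->
  exists (N : nat) (S : {set 'I_N * 'I_N}) (e : 'I_N * 'I_N),
  [/\ e.1 < e.2, e \notin S,
      exists2 phi : et (subK S) -> 'I_q, free phi & forall e, Pal (phi e)
    & forall phi : et (subK (e |: S)) -> 'I_q, (forall e, Pal (phi e)) -> ~ free phi].
Proof.
move=> Pc0; have [N HN] := subK_not_colorable.
pose Pr (S : {set 'I_N * 'I_N}) := exists2 phi : et (subK S) -> 'I_q, free phi & forall e, Pal (phi e).
have [||S [e [eS PS nP]]] := @critical_set _ Pr.
- exists (fun=> c0) => // i; case: ifP => _ [s [sz us cs]].
    case: s sz us cs => [|x [|y s]] sz us; try by move: l3; rewrite -sz.
    case/andP=> /monoP[e [_ /joinsP /=]]; rewrite inE andbF => J _.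
    by have : x = y; [case: J => -[-> ->]|move=> E; move: us; rewrite E /= inE eqxx].
  case: s sz us cs => [|x [|y s]] sz us; try by move: t3; rewrite -sz.
  case/andP=> /andP[/monoP[e [_ /joinsP /=]]]; rewrite inE andbF => J _ _.
  by have : x = y; [case: J => -[-> ->]|move=> E; move: us; rewrite E /= inE eqxx].
- by case=> phi fphi _; apply: HN; exists phi.
exists N, S, e; split=> //; last by move=> phi Pphi fphi; apply: nP; exists phi.
(* If [e.1 < e.2] fails, [e] is a loop whether or not it belongs to the set, so adding it could not
   be critical. *)
apply: contra_notT nP => ne; case: PS => phi fphi Pphi; exists phi => //.
apply: good_sub fphi => i x y /monoP[e' [Ei J]]; apply/monoP; exists e'; split=> //.
move: J; rewrite /joins /= !inE; case: (eqVneq e' e) => [->|//].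
by rewrite (negbTE ne).
Qed.

(* Recolouring the missing edge of a critical graph by i < q1 must close an i-cycle,
   which leaves the end r of that edge through a further i-edge. *)
Lemma rooted_block : 0 < q -> exists (B : mgraph) (r : vt B),
  colorable B /\
  forall phi : et B -> 'I_q, free phi -> forall i : 'I_q, i < q1 ->
    exists2 z, z != r & mono phi i r z.
Proof.
move=> q0; have [N [S [e [e12 eS [phi0 free0 _] crit]]]] := @critical_graph predT (Ordinal q0) isT.
exists (subK S), e.1; split; first by exists phi0.
move=> phi fphi i iq; apply: NNPP => H.
pose phi' : et (subK (e |: S)) -> 'I_q := fun e' => if e' == e then i else phi e'.
have mono_other j : j != i -> subrel (mono phi' j) (mono phi j).
  move=> ji x y /monoP[e' []]; rewrite /phi'; case: (eqVneq e' e) => [_ Eij|ne Ej J].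
    by rewrite Eij eqxx in ji.
  apply/monoP; exists e'; split=> //; move: J; rewrite /joins /= !inE.
  by rewrite (negbTE ne).
have mono_i x y : mono phi' i x y ->
    mono phi i x y \/ (x = e.1 /\ y = e.2 \/ x = e.2 /\ y = e.1).
  case/monoP=> e' []; rewrite /phi'; case: (eqVneq e' e) => [-> _ /joinsP|ne Ej J].
    by rewrite /= e12 !inE eqxx /=; case=> -[-> ->]; right; [left|right].
  left; apply/monoP; exists e'; split=> //; move: J; rewrite /joins /= !inE.
  by rewrite (negbTE ne).
apply: (crit phi') => // j; case: (eqVneq j i) => [->|ji]; last first.
  have := fphi j; case: ifP => _ h k; apply: h.
    exact: has_cycle_sub (mono_other j ji) k.
  exact: has_clique_sub (mono_other j ji) k.
rewrite iq => -[s [sz us cs]].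
have [rs|rs] := boolP (e.1 \in s); last first.
  have := fphi i; rewrite iq; apply; exists s; split=> //.
  apply: cycle_from_next => // x xs; case: (mono_i _ _ (next_cycle cs xs)) => // -[[E _]|[_ E]].
    by rewrite -E xs in rs.
  by move: rs; rewrite -E mem_next xs.
have [n p Ep] := rot_to rs.
have up : uniq (e.1 :: p) by rewrite -Ep rot_uniq.
have cp : cycle (mono phi' i) (e.1 :: p) by rewrite -Ep rot_cycle.
have szp : size (e.1 :: p) = l by rewrite -Ep size_rot.
case: p => [|a p] in up cp szp {Ep}; first by move: l3; rewrite -szp.
case: (lastP p) => [|p' b] in up cp szp *; first by move: l3; rewrite -szp.
have ra : mono phi' i e.1 a by case/andP: cp.
have rb : mono phi' i e.1 b.
  move: cp; rewrite /= rcons_path => /and3P[_ _]; rewrite last_rcons.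
  by rewrite mono_symmetric.
have ab : a != b.
  move: up; rewrite /= mem_rcons inE negb_or => /and3P[_ /andP[]] //.
have ar : a != e.1 by move: up; rewrite /= inE negb_or eq_sym => /andP[/andP[]].
have br : b != e.1 by move: up; rewrite /= inE mem_rcons inE !negb_or eq_sym (eq_sym b) => /andP[/and3P[]].
have bad z : mono phi' i e.1 z -> z != e.1 -> z = e.2.
  move=> m zr; case: (mono_i _ _ m) => [m'|[[_ ->]|[_ E]]] //.
    by case: H; exists z.
  by rewrite E eqxx in zr.
by move: ab; rewrite (bad a) // (bad b) // eqxx.
Qed.

End Mono.

(** * Gadgets *)

Definition near (m n : nat) : bool := (m <= n.+1) && (n <= m.+1).

Lemma near_sym m n : near m n = near n m.
Proof. by rewrite /near andbC. Qed.

Lemma near_refl m : near m m.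
Proof. by rewrite /near leqnSn. Qed.

Lemma cycle_fst_neq (T A : eqType) (s : seq (T * A)) :
  1 < size s -> uniq (map fst s) -> cycle (fun p q => p.1 != q.1) s.
Proof.
move=> s1 us; have us' := map_uniq us; apply: cycle_from_next => // p ps.
apply: contraNneq (next_neq us' s1 ps) => E; apply/eqP.
by apply: (uniq_map_inj us); rewrite ?mem_next.
Qed.

(** Each vertex of a cycle lies in two different pieces, hence has the form [io v]. Sending the
    pieces to hyperedges by [h] yields a cycle of the same length for [V']. *)
Lemma no_short_cycle_hom (T A T' A' : eqType) (V : A -> pred T) (V' : A' -> pred T') g
    (h : A -> A') (io : T' -> T) :
  (forall a b x, a != b -> V a x -> V b x -> (exists v, x = io v) /\ h a != h b) ->
  (forall a v, V a (io v) -> V' (h a) v) ->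
  no_short_cycle V' g -> no_short_cycle V g.
Proof.
move=> H1 H2 girth s s1 us cs ns.
have us' := map_uniq us.
have junction p : p \in s -> (exists v, p.1 = io v) /\ h (prev s p).2 != h p.2.
  move=> ps; have /andP[_ V2] := prev_cycle cs ps.
  by have /andP[V1 _] := next_cycle cs ps; apply: H1 V2 V1; apply: prev_cycle ns ps.
have [s' Es] : exists s', s = [seq (io q.1, q.2) | q <- s'].
  by apply: map_preimage => -[x a] /junction[[v /= ->] _]; exists (v, a).
have hs : cycle (fun p q => h p.2 != h q.2) s.
  apply: cycle_from_next => // p ps.
  have nps : next s p \in s by rewrite mem_next.
  by have [_] := junction _ nps; rewrite prev_next.
apply: (girth [seq (q.1, h q.2) | q <- s']).
- by move: s1; rewrite Es !size_map.
- by move: us; rewrite Es -!map_comp => us; apply: (@map_uniq _ _ io); rewrite -map_comp.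
- move: cs; rewrite Es !cycle_map; apply: sub_cycle => -[v a] [v' a'] /= /andP[h1 h2].
  by rewrite !H2.
- by move: hs; rewrite Es !cycle_map.
Qed.

Section Gadgets.
Variables (q1 q l t : nat).
Hypotheses (l3 : 2 < l) (t3 : 2 < t).
Local Notation free := (@free q1 q l t _).
Local Notation colorable := (@colorable q1 q l t).

Definition mono_path (G : mgraph) (phi : et G -> 'I_q) (c : 'I_q) (e : nat) (x y : vt G) : Prop :=
  exists p, [/\ path (mono phi c) x p, last x p = y, size p = e & uniq (x :: p)].

(* Every two terminals are at distance at least e, witnessed by potentials. *)
Definition spread (e : nat) (G : mgraph) (Y : finType) (y : Y -> vt G) : Prop :=
  forall a, exists f : vt G -> nat,
    [/\ f (y a) = 0, forall b, b != a -> f (y b) = e & forall x, near (f (src x)) (f (tgt x))].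

Definition connects_every (e : nat) (G : mgraph) (Y : finType) (y : Y -> vt G) : Prop :=
  forall phi : et G -> 'I_q, free phi -> forall c : 'I_q, c < q1 ->
    exists a b, a != b /\ mono_path phi c e (y a) (y b).

(** The colour is prescribed separately at each terminal; this is the form needed when every
    terminal carries a spoke with a colour of its own. *)
Definition connects_some (e : nat) (G : mgraph) (Y : finType) (y : Y -> vt G) : Prop :=
  forall phi : et G -> 'I_q, free phi -> forall s : Y -> 'I_q, (forall a, s a < q1) ->
    exists a b, [/\ a != b, s a = s b & mono_path phi (s a) e (y a) (y b)].

Lemma connects_some_every e G (Y : finType) (y : Y -> vt G) :
  connects_some e y -> connects_every e y.
Proof.
move=> H phi fphi c cq; have [//|a [b [ab _ p]]] := H phi fphi (fun=> c).
by exists a, b.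
Qed.

Variables (B : mgraph) (r : vt B).
Hypothesis B_col : colorable B.
Hypothesis B_root : forall phi : et B -> 'I_q, free phi -> forall i : 'I_q, i < q1 ->
    exists2 z, z != r & mono phi i r z.

Lemma block_connects : [/\ injective (@id (vt B)), spread 1 (@id (vt B)) & connects_every 1 (@id (vt B))].
Proof.
split=> //.
- move=> a; exists (fun v => (v != a) : nat); split=> [|b|x]; first by rewrite eqxx.
    by move=> ->.
  by rewrite /near; case: (_ == _); case: (_ == _).
- move=> phi fphi c cq; have [z zr m] := B_root fphi cq.
  exists r, z; split; first by rewrite eq_sym.
  by exists [:: z]; split=> //=; rewrite ?m // inE eq_sym zr.
Qed.

Section Even.
Local Notation F := 'I_q1.+1.
Variables (V A : finType) (inc : A -> F * vt B -> V).
Hypothesis inc_inj : forall a, injective (inc a).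
Hypothesis inc_girth : no_short_cycle (on_edge inc) l.
Hypothesis inc_mono : forall k : V -> {set F * 'I_q}, exists a, forall x x', k (inc a x) = k (inc a x').

(** The gadget of length 2: for every hyperedge and every [f] a block whose root is a private
    terminal and whose other vertices sit on the hyperedge, in disjoint places for distinct [f].
    There are [q1 + 1] values of [f] so that two of them share a cycle colour. *)
Definition star_io (a : A * F) (v : vt B) : V + A * F :=
  if v == r then inr a else inl (inc a.1 (a.2, v)).

Definition star_graph : mgraph := glue (P := fun=> B) star_io.

Definition star_root (a : A * F) : vt star_graph := inr a.

Lemma star_io_inj a : injective (star_io a).
Proof.
move=> v v'; rewrite /star_io; case: (eqVneq v r) => [->|_]; case: (eqVneq v' r) => // _.
by case=> /inc_inj[].
Qed.

Lemma star_colorable : colorable star_graph.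
Proof.
apply: (colorable_glue l3 t3) => //; first exact: star_io_inj.
apply: (no_short_cycle_hom (h := fst) (io := inl)) inc_girth.
  move=> [h f] [h' f'] x ne /existsP[v /eqP]; rewrite /star_io /=.
  case: eqP => [_ <-|_ <-] /existsP[v' /eqP]; case: eqP => // _.
    by case=> E1 E2; rewrite E1 E2 eqxx in ne.
  case=> E; split; first by exists (inc h (f, v)).
  by apply: contraNneq ne => Eh; move: E; rewrite Eh => /inc_inj[->].
move=> [h f] v /existsP[u /eqP]; rewrite /star_io /=; case: eqP => // _ [<-].
by apply/existsP; exists (f, u).
Qed.

Lemma star_spread : spread 2 star_root.
Proof.
move=> a; exists (fun x => if x is inr b then if b == a then 0 else 2 else 1); split=> [|b /negbTE /= ->|[b x] /=] //.
  by rewrite /= eqxx.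
by rewrite /star_io; case: (_ == r); case: (_ == r); case: (b == a).
Qed.

Lemma star_connects : connects_some 2 star_root.
Proof.
move=> phi fphi s sq.
have reach b : exists2 v, v != r & mono phi (s b) (inr b) (star_io b v).
  have [v vr m] := B_root (free_on_piece (@star_io_inj b) fphi) (sq b).
  by exists v => //; have := mono_on_piece m; rewrite (_ : star_io b r = inr b) // /star_io eqxx.
(* [k v] lists the pairs of an index and a colour realised by a root that sends an edge of its
   prescribed colour to [v]. Where [k] is constant on a hyperedge, the edge of the second root is
   transported to the neighbour of the first, at the price of changing the second root's hyperedge
   to some [h']. *)
pose k v := [set fc : F * 'I_q | [exists h, (s (h, fc.1) == fc.2) && mono phi fc.2 (inr (h, fc.1)) (inl v)]].
have [h hmono] := inc_mono k.
have [f [f' [ff' Es]]] : exists f f' : F, f != f' /\ s (h, f) = s (h, f').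
  apply: NNPP => H; have : injective (fun f : F => Ordinal (sq (h, f))).
    move=> f f' [] /val_inj E; apply/eqP/negPn/negP => ff'.
    by apply: H; exists f, f'.
  by move/leq_card; rewrite !card_ord ltnn.
have [v vr m] := reach (h, f); have [v' vr' m'] := reach (h, f').
rewrite /star_io (negbTE vr) (negbTE vr') /= in m m'.
have : (f', s (h, f)) \in k (inc h (f, v)).
  rewrite (hmono _ (f', v')) inE; apply/existsP; exists h.
  by rewrite /= -Es eqxx /=; move: m'; rewrite -Es.
rewrite inE => /existsP[h' /andP[/= /eqP Es' m2]].
exists (h, f), (h', f'); split=> //.
  by rewrite xpair_eqE (negbTE ff') andbF.
exists [:: inl (inc h (f, v)); inr (h', f')]; split=> //=.
  by rewrite m (mono_symmetric phi) m2.
rewrite !inE /= andbT; apply/eqP => -[_ E]; by rewrite E eqxx in ff'.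
Qed.

End Even.
End Gadgets.

(** * Lengthening a gadget by two *)

Section Extend.
Variables (q1 q l t : nat).
Hypotheses (l3 : 2 < l) (t3 : 2 < t).
Local Notation free := (@free q1 q l t _).
Local Notation colorable := (@colorable q1 q l t).
Variables (B : mgraph) (r : vt B).
Hypothesis B_col : colorable B.
Hypothesis B_root : forall phi : et B -> 'I_q, free phi -> forall i : 'I_q, i < q1 ->
    exists2 z, z != r & mono phi i r z.
Variables (e : nat) (C : mgraph) (Y : finType) (y : Y -> vt C).
Hypotheses (y_inj : injective y) (C_col : colorable C) (C_spread : spread e y).
Hypothesis C_conn : @connects_every q1 q l t e C Y y.
Variables (V A : finType) (inc : A -> vt B * Y -> V).
Hypothesis inc_inj : forall a, injective (inc a).
Hypothesis inc_girth : no_short_cycle (on_edge inc) l.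
Hypothesis inc_mono : forall k : V -> vt B * 'I_q, exists a, forall x x', k (inc a x) = k (inc a x').

Local Notation I := (V + A * vt B)%type.
Local Notation W := (V * vt B + (A * vt B) * vt C)%type.

Definition ext_piece (a : I) : mgraph := if a is inl _ then B else C.

(** A block stands at each hypergraph vertex. For every hyperedge [h] and non-root vertex [z] of
    [B], a copy of [C] has terminal [a] placed on the vertex [z] of the block at [inc h (z, a)].
    Copies with [z = r] stay detached. *)
Definition ext_site (k : A * vt B) (w : vt C) : W :=
  if k.2 == r then inr (k, w)
  else if [pick a | y a == w] is Some a then inl (inc k.1 (k.2, a), k.2) else inr (k, w).

Definition ext_io (a : I) : vt (ext_piece a) -> W :=
  match a return vt (ext_piece a) -> W with
  | inl i => fun v => inl (i, v)
  | inr k => ext_site k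
  end.

Definition ext_graph : mgraph := glue ext_io.

Definition ext_root (i : V) : vt ext_graph := inl (i, r).

Lemma ext_site_y k a : k.2 != r -> ext_site k (y a) = inl (inc k.1 (k.2, a), k.2).
Proof.
move=> /negbTE kr; rewrite /ext_site kr; case: pickP => [b /eqP/y_inj ->//|/(_ a)].
by rewrite eqxx.
Qed.

Variant ext_site_spec (k : A * vt B) (w : vt C) : W -> Prop :=
| ExtTerminal a of k.2 != r & w = y a : ext_site_spec k w (inl (inc k.1 (k.2, a), k.2))
| ExtPrivate : ext_site_spec k w (inr (k, w)).

Lemma ext_siteP k w : ext_site_spec k w (ext_site k w).
Proof.
rewrite /ext_site; case: eqP => [_|/eqP kr]; first exact: ExtPrivate.
case: pickP => [a /eqP Ea|_]; last exact: ExtPrivate.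
exact: ExtTerminal (esym Ea).
Qed.

Lemma ext_io_inj a : injective (@ext_io a).
Proof.
case: a => [i|k] /=; first by move=> v v' [].
move=> w w'; case: ext_siteP => [a kr ->|]; case: ext_siteP => [b _ ->|] //.
  by case=> /inc_inj[->].
by case.
Qed.

Let on (a : I) (x : W) := [exists v, @ext_io a v == x].

Lemma on_B i x : on (inl i) x -> exists v, x = inl (i, v).
Proof. by case/existsP=> v /= /eqP <-; exists v. Qed.

Lemma on_C k i v : on (inr k) (inl (i, v)) -> v = k.2 /\ exists a, i = inc k.1 (k.2, a).
Proof.
case/existsP=> w /= /eqP; case: ext_siteP => [a kr _ [<- <-]|//].
by split=> //; exists a.
Qed.

Lemma on_private a k w : on a (inr (k, w)) -> a = inr k.
Proof.
case: a => [i /on_B[] //|k' /existsP[w' /eqP /=]].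
by case: ext_siteP => // -[->].
Qed.

Let lnk (p p' : W * I) := [&& on p.2 p.1, on p.2 p'.1, on p'.2 p'.1, p.1 != p'.1 & p.2 != p'.2].
Let lnk1 (p p' : V * A) :=
  [&& on_edge inc p.2 p.1, on_edge inc p.2 p'.1, p.1 != p'.1 & p.2 != p'.2].
Let proj (p : W * I) : option (V * A) :=
  match p with (inl (i, _), inr k) => Some (i, k.1) | _ => None end.

(* The trace in the hypergraph of a walk through the pieces, up to its last entry p
   with trace c: either p lies in a copy of C, or in the copy of B at the vertex v that
   the copy of C in c is leaving. *)
Definition trace_end (p : W * I) (c : V * A) : Prop :=
  match p with
  | (inl (i, v), inr k) => v = k.2 /\ c = (i, k.1)
  | (inl (i, v), inl j) => [/\ j = i, c.1 != i, on_edge inc c.2 c.1 & exists a, inc c.2 (v, a) = i]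
  | _ => False
  end.

Lemma lnk_site p p' : lnk p p' -> exists x, p'.1 = inl x.
Proof.
case: p' => -[x|[k w]] a' /and5P[_ h1 h2 _ n]; first by exists x.
by move: n; rewrite (on_private h1) (on_private h2) eqxx.
Qed.

Lemma trace i0 k0 s : on (inr k0) (inl (i0, k0.2)) ->
  let p0 := (inl (i0, k0.2), inr k0) : W * I in
  path lnk p0 s ->
  path lnk1 (i0, k0.1) (pmap proj s) /\
  trace_end (last p0 s) (last (i0, k0.1) (pmap proj s)).
Proof.
move=> on0 p0; elim/last_ind: s => [|s p IHs]; first by [].
rewrite rcons_path -cats1 pmap_cat cat_path !last_cat => /andP[/IHs[P1]] /=.
set c := last _ (pmap _ s); set pl := last p0 s => T L.
have [[i v] Ep] := lnk_site L.
case: p Ep L => _ a /= -> /and5P[/= L1 L2 L3 L4 L5].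
case: pl T L1 L2 L4 L5 => -[[il vl]|//] [j|k] /=.
  case=> -> c1 c2 [b Eb] _ /on_B[v' [Ei Ev]] nx na.
  case: a L3 na => [j' /on_B[_ [Ej _]]|k' /on_C[Ek [b' Eb']] _]; first by rewrite -Ej Ei eqxx.
  rewrite /= P1 andbT; split=> //; rewrite /lnk1 /= c2 /= Ei c1 /=.
  apply/andP; split; first by apply/existsP; exists (vl, b); rewrite Eb.
  apply: contraNneq nx => Ec; move: Eb; rewrite Ec -Ei Eb' => /inc_inj[-> _].
  by rewrite Ek.
case=> Evl -> onk /on_C[Ev [b Eb]] nx na.
have [_ [bl Ebl]] := on_C onk.
have ni : il != i by apply: contraNneq nx => ->; rewrite Ev Evl.
case: a L3 na => [j' /on_B[_ [<- _]] _|k' /on_C[Ek [b' Eb']] na]; rewrite /= P1.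
  split=> //; split=> //.
    by apply/existsP; exists (k.2, bl); rewrite Ebl.
  by exists b; rewrite Ev Eb.
split=> //; rewrite andbT; apply/and4P; split=> //=.
- by apply/existsP; exists (k.2, bl); rewrite Ebl.
- by apply/existsP; exists (k.2, b); rewrite Eb.
rewrite ni /=; apply: contraNneq na => E; apply/eqP; congr inr;
   by rewrite [k]surjective_pairing [k']surjective_pairing E -Ev -Ek.
Qed.

(** Distinct blocks are disjoint, so a cycle has an entry in a copy of [C]. Read from there, its
    trace is a closed walk without backtracking in the hypergraph, no longer than the cycle. *)
Lemma ext_girth : no_short_cycle on l.
Proof.
move=> s /andP[s1 sl] us cs ns.
have xs := cycle_fst_neq s1 us; have us' := map_uniq us.
have ls : cycle lnk s.
  apply: cycle_from_next => // p ps.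
  have /andP[h1 h2] := next_cycle cs ps.
  have nps : next s p \in s by rewrite mem_next.
  have /andP[h3 _] := next_cycle cs nps.
  by rewrite /lnk h1 h2 h3 (next_cycle xs ps) (next_cycle ns ps).
have [p0 p0s [i0 [k0 Ep0]]] : exists2 p, p \in s & exists i k, p = (inl (i, k.2), inr k).
  have [p ps [k Ek]] : exists2 p, p \in s & exists k, p.2 = inr k.
    have [p ps] : exists p, p \in s by case: s s1 {us us' cs ns xs ls sl} => // p s' _; exists p; apply: mem_head.
    have nps : next s p \in s by rewrite mem_next.
    have L := next_cycle ls ps; have [[i v] Ex'] := lnk_site L.
    move: L => /and5P[_]; rewrite Ex' => h2 h3 _ na.
    case Ea: p.2 h2 na => [j|k]; last by exists p => //; exists k.
    case Ea': (next s p).2 h3 => [j'|k] h3; last by exists (next s p) => //; exists k.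
    move=> /on_B[_ [E1 _]]; have [_ [E2 _]] := on_B h3.
    by rewrite -E1 -E2 eqxx.
  have L := prev_cycle ls ps; have [[i v] Ex] := lnk_site L.
  exists p => //; exists i, k; move: L => /and5P[_ _ + _ _].
  by rewrite Ek Ex [p]surjective_pairing Ek Ex => /on_C[->].
have [n p Er] := rot_to p0s.
have lr : cycle lnk (p0 :: p) by rewrite -Er rot_cycle.
have szp : size (p0 :: p) <= l by rewrite -Er size_rot.
move: lr; rewrite Ep0 /= rcons_path => /andP[pp lp].
have on0 : on (inr k0) (inl (i0, k0.2)) by case/and5P: lp.
have [P1 T] := trace on0 pp.
have szw : size (pmap proj p) < l.
  by apply: leq_trans szp; rewrite /= ltnS size_pmap count_size.
move: T lp; set c := last _ (pmap _ _); case: (last _ p) => -[[i v]|//] [j|k] /=.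
  case=> -> c1 c0 c2 /and5P[/= _ /on_B[_ [Ei _]] _ _ _].
  case: c2 => b Eb; apply: (no_closed_walk inc_girth P1) => //; rewrite -/c.
  - by apply/existsP; exists (v, b); rewrite Eb Ei.
  - by rewrite Ei.
case=> Ev Ec /and5P[/= onk /on_C[Ek [b Eb]] _ nx _].
have [_ [b' Eb']] := on_C onk.
apply: (no_closed_walk inc_girth P1) => //; rewrite -/c Ec /=.
- by apply/existsP; exists (k.2, b'); rewrite Eb'.
- by apply/existsP; exists (k.2, b); rewrite Eb.
- by apply: contraNneq nx => ->; rewrite Ek Ev.
Qed.

Lemma ext_colorable : colorable ext_graph.
Proof.
apply: (colorable_glue l3 t3); [exact: ext_io_inj | exact: ext_girth | by case].
Qed.

(** The potential is 0 at the root of block [i] and 1 on the rest of that block. A copy of [C]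
    placed there climbs from 1 to [e + 1] by the potential of its terminal in block [i]; everything
    else has value [e + 1], except the other roots with [e + 2]. *)
Lemma ext_spread : spread e.+2 ext_root.
Proof.
move=> i; have [f Hf] := fin_all_exists C_spread.
pose g k w := if [pick a | inc k.1 (k.2, a) == i] is Some a then (f a w).+1 else e.+1.
exists (fun x => match x with
  | inl (j, v) => if v == r then (if j == i then 0 else e.+2) else (if j == i then 1 else e.+1)
  | inr (k, w) => g k w end); split=> [|j /negbTE /= ->|[a x]] /=; rewrite ?eqxx //.
case: a x => [j|k] x /=.
  by rewrite /near; case: (src x == r); case: (tgt x == r); case: (j == i); lia.
suff Eg w : match ext_site k w with
  | inl (j, v) => if v == r then (if j == i then 0 else e.+2) else (if j == i then 1 else e.+1)
  | inr (k, w) => g k w end = g k w.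
  rewrite !Eg /g; case: pickP => [a _|_]; last exact: near_refl.
  by have [_ _ /(_ x)] := Hf a.
case: ext_siteP => [a kr ->|//]; rewrite (negbTE kr) /g.
case: pickP => [b /eqP Eb|/(_ a) ->//].
have [f0 fe _] := Hf b; case: (eqVneq a b) => [->|ab]; first by rewrite Eb eqxx f0.
rewrite (fe a ab) -Eb; case: eqP => // /inc_inj[E]; by rewrite E eqxx in ab.
Qed.

(** Colour a hypergraph vertex [i] by [s i] and a neighbour [Z i] of its root in that colour. On a
    monochromatic hyperedge, the copy of [C] for the common neighbour joins two terminals, and a
    root edge at each end adds 2 to the length. *)
Lemma ext_connects : 0 < q1 -> q1 <= q -> connects_some q1 q l t e.+2 ext_root.
Proof.
move=> q10 q1q phi fphi s sq.
have root_edge i : exists z, z != r /\ mono phi (s i) (inl (i, r)) (inl (i, z)).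
  have [z zr m] := B_root (free_on_piece (a := inl i) (@ext_io_inj _) fphi) (sq i).
  by exists z; split=> //; have := mono_on_piece (io := ext_io) (a := inl i) m.
have [Z HZ] := fin_all_exists root_edge.
have [a0 _] : exists a0 : Y, true.
  case: C_col => psi fpsi; have q0 : 0 < q := leq_trans q10 q1q.
  by have [|a _] := C_conn fpsi (c := Ordinal q0); last exists a.
have [h hm] := inc_mono (fun i => (Z i, s i)).
set i0 := inc h (r, a0); have hE x : Z (inc h x) = Z i0 /\ s (inc h x) = s i0.
  by have [] := hm x (r, a0).
pose k : A * vt B := (h, Z i0); have [zr _] := HZ i0.
have fk := free_on_piece (a := inr k) (@ext_io_inj _) fphi.
have [a [b [ab [p [pp lp sp up]]]]] := C_conn fk (sq i0).
have ninc : inc h (Z i0, a) != inc h (Z i0, b) by apply: contraNneq ab => /inc_inj[->].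
exists (inc h (Z i0, a)), (inc h (Z i0, b)); split=> //.
  by rewrite (hE (Z i0, a)).2 (hE (Z i0, b)).2.
have Ey c : ext_site k (y c) = inl (inc h (Z i0, c), Z i0) by apply: ext_site_y.
have start c : mono phi (s i0) (ext_root (inc h (Z i0, c))) (ext_site k (y c)).
  by have [_] := HZ (inc h (Z i0, c)); rewrite (hE _).1 (hE _).2 Ey.
have not_root j w : ext_site k w != inl (j, r).
  case: ext_siteP => [c kr _|//]; apply/eqP => -[_ E]; by rewrite /= E eqxx in kr.
rewrite (hE _).2; exists (rcons (map (ext_site k) (y a :: p)) (ext_root (inc h (Z i0, b)))); split.
- rewrite rcons_path /= start /= last_map lp mono_symmetric start andbT.
  by rewrite path_map; apply: sub_path pp => u v m; have := mono_on_piece (io := ext_io) (a := inr k) m.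
- by rewrite last_rcons.
- by rewrite size_rcons size_map /= sp.
rewrite cons_uniq mem_rcons rcons_uniq in_cons negb_or -andbA; apply/and4P; split.
- by apply: contraNneq ninc => -[->].
- by apply/negP => /mapP[w _ E]; have := not_root (inc h (Z i0, a)) w; rewrite -E eqxx.
- by apply/negP => /mapP[w _ E]; have := not_root (inc h (Z i0, b)) w; rewrite -E eqxx.
by rewrite (map_inj_uniq (@ext_io_inj (inr k))).
Qed.

End Extend.

Section Exists.
Variables (q1 q l t : nat).
Hypotheses (l3 : 2 < l) (t3 : 2 < t) (q10 : 0 < q1) (q1q : q1 <= q).

Lemma gadget_exists e : exists (C : mgraph) (Y : finType) (y : Y -> vt C),
  [/\ injective y, colorable q1 q l t C, spread e.+2 y & connects_some q1 q l t e.+2 y].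
Proof.
have q0 : 0 < q := leq_trans q10 q1q.
have [B [r [B_col B_root]]] := rooted_block q1 l3 t3 q0.
(* A step adds 2 to the length, so both parities need a start: the block itself for length 1, which
   gives only [connects_every], and the star graph for length 2. Two consecutive lengths are carried
   along. *)
suff H n : (exists (C : mgraph) (Y : finType) (y : Y -> vt C),
    [/\ injective y, colorable q1 q l t C, spread n.+1 y & connects_every q1 q l t n.+1 y]) /\
  (exists (C : mgraph) (Y : finType) (y : Y -> vt C),
    [/\ injective y, colorable q1 q l t C, spread n.+2 y & connects_some q1 q l t n.+2 y]).
  by have [] := H e.
have step n' : (exists (C : mgraph) (Y : finType) (y : Y -> vt C),
    [/\ injective y, colorable q1 q l t C, spread n' y & connects_every q1 q l t n' y]) ->
  (exists (C : mgraph) (Y : finType) (y : Y -> vt C),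
    [/\ injective y, colorable q1 q l t C, spread n'.+2 y & connects_some q1 q l t n'.+2 y]).
  case=> C [Y [y [y1 y2 y3 y4]]].
  have [|V [A [inc [i1 i2 i3]]]] :=
    @chromatic_girth_all l (vt B * Y)%type (vt B * 'I_q)%type.
    by apply/card_gt0P; exists (r, Ordinal q0).
  exists (ext_graph r y inc), V, (ext_root r y inc); split.
  - by move=> i j [].
  - exact: ext_colorable.
  - exact: ext_spread.
  - exact: ext_connects.
elim: n => [|n [IH1 IH2]]; split.
- by have [? ? ?] := block_connects B_root; exists B, (vt B), id.
- have [|V [A [inc [i1 i2 i3]]]] :=
    @chromatic_girth_all l ('I_q1.+1 * vt B)%type {set 'I_q1.+1 * 'I_q}.
    by apply/card_gt0P; exists set0.
  exists (star_graph r inc), (A * 'I_q1.+1)%type, (star_root r inc); split.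
  - by move=> a b [].
  - exact: star_colorable.
  - exact: star_spread.
  - exact: star_connects.
- have [C [Y [y [y1 y2 y3 y4]]]] := IH2; exists C, Y, y; split=> //.
  exact: connects_some_every.
- exact: step IH1.
Qed.

End Exists.

(** * Forcing a cycle colour *)

Lemma path_potential (T : Type) (R : rel T) (f : T -> nat) x p :
  (forall a b, R a b -> f b <= (f a).+1) -> path R x p -> f (last x p) <= f x + size p.
Proof.
move=> lip; elim: p x => [|y p IHp] x /=; first by rewrite addn0.
case/andP=> xy /IHp le; apply: leq_trans le _; rewrite addnS -addSn leq_add2r; exact: lip.
Qed.

Section Collapse.
Variables (q1 q l t : nat).
Hypotheses (l3 : 2 < l) (t3 : 2 < t).
Local Notation good := (@good q1 q l t _).
Variables (T : finType) (R : 'I_q -> rel T) (y z : T).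
Hypothesis R_sym : forall i, symmetric (R i).
Hypothesis yz : y != z.
Hypothesis no_path : forall i : 'I_q, i < q1 -> forall p,
  path (R i) y p -> last y p = z -> size p != l.
Hypothesis no_path3 : forall i x1 x2, R i y x1 -> R i x1 x2 -> ~~ R i x2 z.

Definition collapse (x : T) : T := if x == y then z else x.

Let R' i := img collapse (R i).

Lemma collapse_sym i : symmetric (R' i).
Proof. exact: img_sym. Qed.

Lemma collapse_edge i a b : a != z -> b != z -> R' i a b -> R i a b.
Proof.
move=> az bz /imgP[u [v [Ruv Ea Eb]]]; move: Ea Eb; rewrite /collapse.
case: eqP => [_ Ea|_ <-]; first by rewrite Ea eqxx in az.
by case: eqP => [_ Eb|_ <-] //; rewrite Eb eqxx in bz.
Qed.

Lemma collapse_edge_z i b : b != z -> R' i z b -> R i y b || R i z b.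
Proof.
move=> bz /imgP[u [v [Ruv Ea Eb]]]; move: Ea Eb; rewrite /collapse.
case: (eqVneq v y) => [_ _ Eb|_]; first by rewrite Eb eqxx in bz.
by case: (eqVneq u y) => [<- _|_ <-] <-; rewrite Ruv ?orbT.
Qed.

Lemma collapse_edge_y i a b : R' i a b -> a != y.
Proof.
case/imgP=> u [v [_ <- _]]; rewrite /collapse; case: (eqVneq u y) => // _.
by rewrite eq_sym.
Qed.

Lemma no_path_back (i : 'I_q) p : i < q1 -> path (R i) z p -> last z p = y -> size p != l.
Proof.
move=> iq pz lz; rewrite -(size_belast z p) -size_rev; apply: (no_path iq).
  rewrite -lz rev_path; apply: sub_path pz => a b; by rewrite R_sym.
by case: p lz {pz} => [|a p] /=; [move=> E | rewrite rev_cons last_rcons].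
Qed.

(** A cycle through the merged vertex either has both its edges there from [y], or both from [z], or
    opens to a walk of length [l] between them. In a clique through it, a vertex [x1] seen by [y]
    but not by [z] forces every other [x] to be seen by [y], for otherwise [y, x1, x, z] is a
    forbidden path; so [y] replaces [z]. *)
Lemma good_collapse : good R -> good R'.
Proof.
move=> gR i; have := gR i; case: ifP => iq H [s [sz us cs]]; apply: H.
  have [zs|zs] := boolP (z \in s); last first.
    exists s; split=> //; apply: cycle_from_next => // x xs.
    apply: collapse_edge (next_cycle cs xs).
      by apply: contraNneq zs => <-.
    by apply: contraNneq zs => <-; rewrite mem_next.
  have [n p Ep] := rot_to zs.
  have cp : cycle (R' i) (z :: p) by rewrite -Ep rot_cycle.
  have up : uniq (z :: p) by rewrite -Ep rot_uniq.
  have sp : size (z :: p) = l by rewrite -Ep size_rot.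
  have zp : all (fun x => x != z) p.
    by apply/allP => x xp; move: up => /= /andP[+ _]; apply: contraNneq => <-.
  case: p => [|a p] in up cp sp zp {Ep}; first by move: l3; rewrite -sp.
  move: (cp); rewrite /= rcons_path => /and3P[za pa lz].
  case/andP: (zp) => az pz.
  have lz' : last a p != z.
    by have := mem_last a p; move: zp => /allP H /H.
  have ya : y \notin a :: p.
    apply/negP => yp; have nyp : y \in z :: a :: p by rewrite in_cons yp orbT.
    by have := collapse_edge_y (next_cycle cp nyp); rewrite eqxx.
  have pR : path (R i) a p.
    apply: (sub_in_path (P := fun x => x != z)) pa => //= x1 x2 h1 h2; exact: collapse_edge.
  rewrite collapse_sym in lz.
  case/orP: (collapse_edge_z az za) => h1; case/orP: (collapse_edge_z lz' lz) => h2.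
  - exists (y :: a :: p); split=> //; first by move: up; rewrite /= ya => /andP[_].
    by rewrite /= rcons_path h1 pR R_sym.
  - have := @no_path i iq (a :: rcons p z); rewrite /= h1 rcons_path pR R_sym h2 last_rcons size_rcons -sp /= eqxx.
    by move=> /(_ isT erefl).
  - have := @no_path_back i (a :: rcons p y) iq; rewrite /= h1 rcons_path pR R_sym h2 last_rcons size_rcons -sp /= eqxx.
    by move=> /(_ isT erefl).
  - exists (z :: a :: p); split=> //; by rewrite /= rcons_path h1 pR R_sym.
have [zs|zs] := boolP (z \in s); last first.
  exists s; split=> //; apply: (sub_in_pairwise (P := fun x => x != z)) cs; last first.
    by apply/allP => x xs; apply/eqP => E; rewrite -E xs in zs.
  by move=> a b az bz; apply: collapse_edge.
have all_R x x' : x \in s -> x' \in s -> x != x' -> R' i x x'.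
  by move=> xs x's; apply: (pairwise_in (@collapse_sym i) cs).
have Rs x x' : x \in s -> x' \in s -> x != x' -> x != z -> x' != z -> R i x x'.
  by move=> *; apply: collapse_edge => //; apply: all_R.
have Rz x : x \in s -> x != z -> R i y x || R i z x.
  by move=> xs xz; apply: collapse_edge_z => //; apply: all_R => //; rewrite eq_sym.
case: (boolP (all (fun x => (x == z) || R i z x) s)) => [/allP az|/allPn[x1 x1s]].
  exists s; split=> //; apply: in_pairwise => // x x' xs x's xx'.
  have [Ex|xz] := eqVneq x z.
    by have := az x' x's; rewrite Ex eq_sym -Ex (negbTE xx').
  have [Ex'|x'z] := eqVneq x' z; last exact: Rs.
  by have := az x xs; rewrite (negbTE xz) Ex' R_sym.
rewrite negb_or => /andP[x1z nx1]; have := Rz x1 x1s x1z; rewrite (negbTE nx1) orbF => y1.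
exists (y :: rem z s); split.
- by rewrite /= size_rem // sz prednK // (leq_trans _ t3).
- rewrite /= rem_uniq // andbT; apply/negP => /mem_rem ys.
  have := collapse_edge_y (all_R y x1 ys x1s _); rewrite eqxx => H.
  suff : y != x1 by move/H.
  by apply/negP => /eqP E; rewrite -E in nx1 x1z *; have := collapse_edge_y (all_R y z ys zs yz); rewrite eqxx.
rewrite pairwise_cons; apply/andP; split; last first.
  apply: in_pairwise; first exact: rem_uniq.
  by move=> x x'; rewrite !mem_rem_uniq // !inE => /andP[? ?] /andP[? ?] ?; apply: Rs.
apply/allP => x; rewrite mem_rem_uniq // !inE => /andP[xz xs].
have [->//|xx1] := eqVneq x x1.
have := Rz x xs xz; case: (R i y x) => //= zx.
have := no_path3 y1 (Rs x1 x x1s xs _ x1z xz); rewrite eq_sym xx1 R_sym zx => /(_ isT).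
by [].
Qed.

End Collapse.

Lemma near_between a m n : a <= m <= a.+1 -> a <= n <= a.+1 -> near m n.
Proof. by rewrite /near; lia. Qed.

Section Recolor.
Variables (q1 q l t : nat).
Local Notation free := (@free q1 q l t _).

Lemma free_sub (G : mgraph) (phi phi' : et G -> 'I_q) :
  (forall i, subrel (mono phi' i) (mono phi i)) -> free phi -> free phi'.
Proof. exact: good_sub. Qed.

(** Parallel edges may carry several colours; giving them all the colour of [d] enlarges no colour
    class as a relation. *)
Lemma free_recolor (G : mgraph) (phi : et G -> 'I_q) (d : et G) : free phi ->
  free (fun e => if joins e (src d) (tgt d) then phi d else phi e).
Proof.
apply: free_sub => i x y /monoP[e []]; case: ifP => [J Ei J'|_ Ei J]; apply/monoP.
  exists d; split=> //; case/joinsP: J => -[E1 E2]; case/joinsP: J' => -[E3 E4];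
    by apply/joinsP; rewrite -E1 -E2 E3 E4; auto.
by exists e.
Qed.

Lemma free_perm (G : mgraph) (phi : et G -> 'I_q) (s : 'I_q -> 'I_q) :
  involutive s -> (forall i, (s i < q1) = (i < q1)) -> free phi -> free (s \o phi).
Proof.
move=> sK s1 fphi i; have := fphi (s i); rewrite s1.
have sub : subrel (mono (s \o phi) i) (mono phi (s i)).
  by move=> x y /monoP[e [/= <- J]]; apply/monoP; exists e; rewrite sK.
case: ifP => _ H k; apply: H; [exact: has_cycle_sub k | exact: has_clique_sub k].
Qed.

Definition swap (a b : 'I_q) (x : 'I_q) : 'I_q :=
  if x == a then b else if x == b then a else x.

Lemma swapK a b : involutive (swap a b).
Proof.
move=> x; rewrite /swap; case: (eqVneq x a) => [->|xa].
  by case: (eqVneq b a) => [->//|_]; rewrite eqxx.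
by case: (eqVneq x b) => [->|xb]; rewrite ?eqxx // (negbTE xa) (negbTE xb).
Qed.

Lemma swap_lt (a b i : 'I_q) : a < q1 -> b < q1 -> (swap a b i < q1) = (i < q1).
Proof.
by move=> ha hb; rewrite /swap; case: eqP => [->|_]; [rewrite ha hb|case: eqP => // ->; rewrite ha hb].
Qed.

Definition forcing (X : pred 'I_q) (G : mgraph) (d : et G) : Prop :=
  [/\ src d != tgt d, forall phi : et G -> 'I_q, free phi -> X (phi d)
    & forall c, X c -> exists2 phi : et G -> 'I_q, free phi & phi d = c].

(** Recolouring parallel edges pins the forced colour to one fixed edge [d], and exchanging two
    cycle colours realises all of them on it. *)
Lemma forcing_cycle (G : mgraph) (x y : vt G) : x != y -> colorable q1 q l t G ->
  (forall phi : et G -> 'I_q, free phi -> exists2 c : 'I_q, c < q1 & mono phi c x y) ->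
  exists d : et G, forcing (fun c : 'I_q => c < q1) d.
Proof.
move=> xy [phi0 free0] H; have [_ _ /monoP[d [_ J]]] := H phi0 free0.
have dq phi : free phi -> phi d < q1.
  move=> fphi; have [c cq /monoP[e []]] := H _ (free_recolor d fphi).
  case: ifP => [_ -> //|/negP n _ Je]; case: n.
  by case/joinsP: J => -[-> ->] //; rewrite joins_sym.
exists d; split=> //; first by case/joinsP: J => -[-> ->]; rewrite // eq_sym.
move=> c cq; exists (swap (phi0 d) c \o phi0); last by rewrite /= /swap eqxx.
apply: (free_perm _ _ free0); first exact: swapK.
by move=> i; apply: swap_lt => //; exact: dq.
Qed.

End Recolor.

(** * The hub graph *)

Section CycleForcing.
Variables (q1 q l t : nat).
Hypotheses (l4 : 3 < l) (t3 : 2 < t) (q10 : 0 < q1) (q1q : q1 <= q).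
Hypotheses (l3 : 2 < l) (q0 : 0 < q).
Local Notation c0 := (Ordinal q0).
Local Notation free := (@free q1 q l t _).
Local Notation colorable := (@colorable q1 q l t).
Variables (B : mgraph) (r : vt B).
Hypothesis B_col : colorable B.
Hypothesis B_root : forall phi : et B -> 'I_q, free phi -> forall i : 'I_q, i < q1 ->
    exists2 z, z != r & mono phi i r z.
Variables (C : mgraph) (Y : finType) (y : Y -> vt C).
Hypotheses (y_inj : injective y) (C_col : colorable C) (C_spread : spread (l - 2) y).
Hypothesis C_conn : @connects_every q1 q l t (l - 2) C Y y.
Variables (V A : finType) (inc : A -> vt B * Y -> V).
Hypothesis inc_inj : forall a, injective (inc a).
Hypothesis inc_girth : no_short_cycle (on_edge inc) 2.
Hypothesis inc_mono : forall k : V -> vt B, exists a, forall x x', k (inc a x) = k (inc a x').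

Local Notation I := (V + A * vt B)%type.
Local Notation W := (option (V * vt B + (A * vt B) * vt C)).

Definition hub_piece (a : I) : mgraph := if a is inl _ then B else C.

(** All blocks share their root, the hub [None]. The set [S] lists the identifications made so far;
    a terminal whose identification is not in [S] stays private to its copy of [C]. *)
Definition hub_site (S : {set (A * vt B) * Y}) (k : A * vt B) (w : vt C) : W :=
  if k.2 == r then Some (inr (k, w))
  else if [pick a | (y a == w) && ((k, a) \in S)] is Some a
  then Some (inl (inc k.1 (k.2, a), k.2)) else Some (inr (k, w)).

Definition hub_io (S : {set (A * vt B) * Y}) (a : I) : vt (hub_piece a) -> W :=
  match a return vt (hub_piece a) -> W with
  | inl i => fun v => if v == r then None else Some (inl (i, v))
  | inr k => hub_site S k
  end.

Definition hub_graph S : mgraph := glue (hub_io S).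

Variant hub_site_spec (S : {set (A * vt B) * Y}) (k : A * vt B) (w : vt C) : W -> Prop :=
| HubTerminal a of k.2 != r & w = y a & (k, a) \in S :
    hub_site_spec S k w (Some (inl (inc k.1 (k.2, a), k.2)))
| HubPrivate of (forall a, w = y a -> k.2 != r -> (k, a) \notin S) :
    hub_site_spec S k w (Some (inr (k, w))).

Lemma hub_siteP S k w : hub_site_spec S k w (hub_site S k w).
Proof.
rewrite /hub_site; case: eqP => [Ek|/eqP kr].
  by apply: HubPrivate => a _; rewrite Ek eqxx.
case: pickP => [a /andP[/eqP Ea aS]|H]; first exact: HubTerminal (esym Ea) aS.
by apply: HubPrivate => a Ew _; have := H a; rewrite Ew eqxx /= => ->.
Qed.

Lemma hub_io_inj S a : injective (@hub_io S a).
Proof.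
case: a => [i|k] /=.
  by move=> v v'; case: (eqVneq v r) => [->|_]; case: (eqVneq v' r) => // _ [].
move=> w w'; case: hub_siteP => [a kr -> _|_]; case: hub_siteP => [b _ -> _|_] //.
  by case=> /inc_inj[->].
by case.
Qed.

Lemma hub_colorable0 : colorable (hub_graph set0).
Proof.
apply: (colorable_glue l3 t3); [exact: hub_io_inj | idtac | by case].
(* Without identifications the hub is the only vertex common to two pieces, and a cycle needs two
   such vertices. *)
apply: (no_short_cycle_hom (h := id) (io := fun _ : unit => None) (V' := fun _ _ => true)) => //.
  move=> a b x ab ax bx; split=> //; exists tt.
  case: x ax bx => // -[[i v]|[k w]].
    case: a b ab => [j|k] [j'|k'] ab /existsP[/= u /eqP Eu] /existsP[/= u' /eqP Eu'].
    - move: Eu Eu'; case: eqP => // _ [Ej _]; case: eqP => // _ [Ej' _].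
      by rewrite Ej Ej' eqxx in ab.
    - by move: Eu'; case: hub_siteP => // ? ? ?; rewrite in_set0.
    - by move: Eu; case: hub_siteP => // ? ? ?; rewrite in_set0.
    - by move: Eu; case: hub_siteP => // ? ? ?; rewrite in_set0.
  case: a b ab => [j|k1] [j'|k2] ab /existsP[/= u /eqP Eu] /existsP[/= u' /eqP Eu'].
  - by move: Eu; case: eqP.
  - by move: Eu; case: eqP.
  - by move: Eu'; case: eqP.
  - move: Eu Eu'; case: hub_siteP => // _ [E1 _]; case: hub_siteP => // _ [E2 _].
    by rewrite E1 E2 eqxx in ab.
move=> [|[[] a] [|[[] b] s]] //= _; by rewrite !inE.
Qed.

(** The single cycle colour [c0] suffices: colour each hypergraph vertex by a [c0]-neighbour of the
    hub in its block. A monochromatic hyperedge gives a path of length [l - 2] between two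
    neighbours of the hub, which closes to a [C_l]. *)
Lemma hub_not_colorable : ~ colorable (hub_graph setT).
Proof.
case=> phi fphi.
have root_edge i : exists z, z != r /\ mono phi c0 None (Some (inl (i, z))).
  have [z zr m] := B_root (free_on_piece (a := inl i) (@hub_io_inj _ _) fphi) (i := c0) q10.
  exists z; split=> //; have := mono_on_piece (io := hub_io setT) (a := inl i) m.
  by rewrite /= eqxx (negbTE zr).
have [Z HZ] := fin_all_exists root_edge.
have [a0 _] : exists a0 : Y, true.
  by case: C_col => psi fpsi; have [|a _] := C_conn fpsi (c := c0); last exists a.
have [h hm] := inc_mono Z; set z := Z (inc h (r, a0)).
have hE x : Z (inc h x) = z := hm x _; pose k : A * vt B := (h, z).
have zr : z != r by have [] := HZ (inc h (r, a0)).
have fk := free_on_piece (a := inr k) (@hub_io_inj _ _) fphi.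
have [a [b [ab [p [pp lp sp up]]]]] := C_conn fk (c := c0) q10.
have start c : mono phi c0 None (hub_site setT k (y c)).
  have [_] := HZ (inc h (z, c)); rewrite hE; case: hub_siteP => [c' _ /y_inj-> _ //|/(_ c erefl zr)/negP[]].
  exact: in_setT.
have := fphi c0; rewrite q10; apply; exists (None :: map (hub_site setT k) (y a :: p)); split.
- by rewrite /= size_map sp; lia.
- rewrite cons_uniq (map_inj_uniq (@hub_io_inj setT (inr k))) up andbT.
  by apply/negP => /mapP[w _]; case: hub_siteP.
rewrite /= start rcons_path last_map lp mono_symmetric start andbT path_map.
by apply: sub_path pp => u v m; have := mono_on_piece (io := hub_io setT) (a := inr k) m.
Qed.

Section Critical.
Variables (S : {set (A * vt B) * Y}) (k : A * vt B) (a : Y).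
Hypotheses (kr : k.2 != r) (aS : (k, a) \notin S).

Let i0 := inc k.1 (k.2, a).
Let yv : W := Some (inr (k, y a)).
Let zv : W := Some (inl (i0, k.2)).

Lemma hub_io_collapse x v : @hub_io ((k, a) |: S) x v = collapse yv zv (@hub_io S x v).
Proof.
case: x v => [i|k'] v /=; first by case: (v == r).
rewrite /collapse; case: (hub_siteP ((k, a) |: S)) => [b k'r -> |nS].
  case/setU1P=> [[-> ->]|bS].
    case: hub_siteP => [b' _ /y_inj<-|_]; last by rewrite eqxx.
    by rewrite (negbTE aS).
  case: hub_siteP => [b' _ /y_inj-> _ //|/(_ b erefl k'r)]; by rewrite bS.
case: hub_siteP => [b k'r Ev bS|_].
  by have := nS b Ev k'r; rewrite in_setU1 bS orbT.
case: eqP => // -[Ek Ev]; rewrite Ek in nS.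
by have := nS a Ev kr; rewrite in_setU1 eqxx.
Qed.

Lemma inc_linear h h' i i' : i != i' -> on_edge inc h i -> on_edge inc h i' ->
  on_edge inc h' i -> on_edge inc h' i' -> h = h'.
Proof.
move=> ii' h1 h2 h3 h4; apply/eqP/negPn/negP => hh'.
apply: (inc_girth (s := [:: (i, h); (i', h')])) => //=.
- by rewrite inE ii'.
- by rewrite h1 h2 h3 h4.
- by rewrite hh' eq_sym hh'.
Qed.

Variable f : Y -> vt C -> nat.
Hypothesis f_spread : forall b, [/\ f b (y b) = 0, forall b', b' != b -> f b (y b') = l - 2
  & forall x, near (f b (src x)) (f b (tgt x))].

Let J (i : V) := [exists b, (b != a) && (inc k.1 (k.2, b) == i)].

(* The potential grows by at most one along each edge of the hub graph except for the
   edge from the hub to zv; it shows that merging yv and zv closes no short cycle. *)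
Definition hub_pot (x : W) : nat :=
  match x with
  | None => l.-1
  | Some (inl (i, v)) =>
      if i == i0 then (if v == k.2 then l.+1 else l)
      else if J i then (if v == k.2 then l - 2 else l.-1) else l
  | Some (inr (k', w)) =>
      if k' == k then f a w
      else if k'.2 == k.2 then
        (if [pick b | J (inc k'.1 (k.2, b))] is Some b then minn l (l - 2 + f b w) else l)
      else l
  end.

(** By linearity of the hypergraph, a copy of [C] on another hyperedge meets that of [k] in at most
    one vertex, so one terminal potential serves for the whole copy. A copy attached at block
    vertices other than [k.2] only takes the values [l - 1] and [l]. *)
Lemma hub_pot_near x y' : (exists e : et (hub_graph S), joins e x y') ->
  near (hub_pot x) (hub_pot y') \/ (x = None /\ y' = zv \/ x = zv /\ y' = None).
Proof.
case=> -[c e] /joinsP H.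
suff H' : near (hub_pot (@hub_io S c (src e))) (hub_pot (@hub_io S c (tgt e))) \/
   (@hub_io S c (src e) = None /\ @hub_io S c (tgt e) = zv \/
    @hub_io S c (src e) = zv /\ @hub_io S c (tgt e) = None).
  case: H => -[/= <- <-] //; rewrite near_sym; case: H' => [->|[[-> ->]|[-> ->]]]; auto.
clear x y' H; case: c e => [i|k'] e /=.
  case: (eqVneq (src e) r) => [_|nr]; case: (eqVneq (tgt e) r) => [_|nr'] /=.
  - by left; apply: near_refl.
  - case: (eqVneq i i0) => [->|_]; first case: (eqVneq (tgt e) k.2) => [->|_]; first by right; left.
      by left; rewrite /near; lia.
    by left; rewrite /near; case: (J i); case: (tgt e == k.2); lia.
  - case: (eqVneq i i0) => [->|_]; first case: (eqVneq (src e) k.2) => [->|_]; first by right; right.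
      by left; rewrite /near; lia.
    by left; rewrite /near; case: (J i); case: (src e == k.2); lia.
  - by left; rewrite /near; case: (i == i0); case: (J i); case: (src e == k.2); case: (tgt e == k.2); lia.
left; case: (eqVneq k' k) => [->|k'k].
  have E w : hub_pot (hub_site S k w) = f a w.
    case: hub_siteP => [b _ -> bS|_] /=; last by rewrite eqxx.
    have ba : b != a by apply: contraNneq aS => <-.
    rewrite ifN; last by apply: contraNneq ba => /inc_inj[->].
    rewrite ifT ?eqxx; first by have [_ ->] := f_spread a.
    by apply/existsP; exists b; rewrite ba eqxx.
  by rewrite !E; have [_ _] := f_spread a.
case: (eqVneq k'.2 k.2) => [Ek|nk]; last first.
  have E w : l.-1 <= hub_pot (hub_site S k' w) <= l.
    case: hub_siteP => [b _ _ _|_] /=; last by rewrite (negbTE k'k) (negbTE nk) leq_pred leqnn.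
    by rewrite (negbTE nk); case: (_ == i0); case: (J _); rewrite ?leq_pred ?leqnn.
  have El : l.-1.+1 = l by apply: prednK; apply: ltn_trans l3.
  by apply: (near_between (a := l.-1)); rewrite El.
have hh' : k'.1 != k.1.
  by apply: contraNneq k'k => E; rewrite [k']surjective_pairing E Ek -surjective_pairing.
have on_k b : on_edge inc k.1 (inc k.1 (k.2, b)) by apply/existsP; exists (k.2, b).
have on_k' b : on_edge inc k'.1 (inc k'.1 (k.2, b)) by apply/existsP; exists (k.2, b).
case: (pickP (fun b => J (inc k'.1 (k.2, b)))) => [b0 Jb0|nJ]; last first.
  have E w : l <= hub_pot (hub_site S k' w) <= l.+1.
    case: hub_siteP => [b _ _ _|_] /=; last first.
      rewrite (negbTE k'k) Ek eqxx; case: pickP => [b|_]; first by rewrite nJ.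
      by rewrite leqnn leqnSn.
    by rewrite Ek eqxx nJ; case: (_ == i0); rewrite ?leqnn ?leqnSn.
  exact: (near_between (a := l)).
have [b1 /andP[b1a /eqP Eb1]] := existsP Jb0.
have lin b b' : b != b0 -> inc k.1 (k.2, b') != inc k'.1 (k.2, b).
  move=> bb0; apply/eqP => E; case/eqP: hh'.
  apply: (@inc_linear _ _ (inc k'.1 (k.2, b)) (inc k'.1 (k.2, b0))) => //.
  - by apply: contraNneq bb0 => /inc_inj[->].
  - by rewrite -E.
  - by rewrite -Eb1.
have E w : hub_pot (hub_site S k' w) = minn l (l - 2 + f b0 w).
  case: hub_siteP => [b _ -> _|_] /=; last first.
    rewrite (negbTE k'k) Ek eqxx; case: pickP => [b Jb|/(_ b0)]; last by rewrite Jb0.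
    have [->//|bb0] := eqVneq b b0; have [b2 /andP[_ /eqP E2]] := existsP Jb.
    by have := lin b b2 bb0; rewrite E2 eqxx.
  rewrite Ek eqxx; have [->|bb0] := eqVneq b b0.
    rewrite Jb0 ifN; first by have [-> _ _] := f_spread b0; rewrite addn0; lia.
    by rewrite -Eb1; apply: contraNneq b1a => /inc_inj[->].
  rewrite ifN; last by rewrite eq_sym lin.
  rewrite ifN; last by apply/existsP => -[b2 /andP[_ /eqP E2]]; have := lin b b2 bb0; rewrite E2 eqxx.
  by have [_ -> //] := f_spread b0; lia.
rewrite !E; have [_ _ /(_ e)] := f_spread b0; rewrite /near; lia.
Qed.

(** If no edge from the hub to [zv] has a cycle colour, a walk from [yv] to [zv] in a cycle colour
    has at least [l + 1] edges. In a clique colour that edge may be present, but a walk of three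
    edges would still have to jump from at most 1 to at least [l - 1 >= 3] in its middle step. So
    the identification would be possible. *)
Lemma hub_forced : ~ colorable (hub_graph ((k, a) |: S)) ->
  forall phi : et (hub_graph S) -> 'I_q, free phi -> exists2 c : 'I_q, c < q1 & mono phi c None zv.
Proof.
move=> ncol phi fphi; apply: NNPP => H; apply: ncol.
have nm (c : 'I_q) : c < q1 -> mono phi c None zv = false.
  by move=> cq; apply: contra_notF H => m; exists c.
exists phi; apply: (@good_sub _ _ _ _ _ _ (fun i => img (collapse yv zv) (mono phi i))).
  move=> i x x' /monoP[[b e] [Ei /joinsP /= J']]; apply/imgP.
  case: J' => -[<- <-]; rewrite !hub_io_collapse.
    exists (@hub_io S b (src e)), (@hub_io S b (tgt e)); split=> //.
    by apply/monoP; exists (Tagged (fun a => et (hub_piece a)) e); split=> //; apply/joinsP; left.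
  exists (@hub_io S b (tgt e)), (@hub_io S b (src e)); split=> //.
  by apply/monoP; exists (Tagged (fun a => et (hub_piece a)) e); split=> //; apply/joinsP; right.
apply: (good_collapse l3 t3) => //; first by move=> i; exact: (@mono_symmetric _ (hub_graph S) phi i).
  move=> i iq p pp lp; apply/eqP => sp.
  have : hub_pot (last yv p) <= hub_pot yv + size p.
    apply: path_potential pp => u v m.
    have [|/andP[]|] // := @hub_pot_near u v; first by case/monoP: m => e [_ J']; exists e.
    case=> -[Eu Ev]; move: m; rewrite Eu Ev ?(mono_symmetric phi i zv) nm //.
  rewrite lp sp /= !eqxx; have [-> _ _] := f_spread a; lia.
move=> i x1 x2 /monoP[e1 [_ J1]] /monoP[e2 [_ J2]]; apply/negP => /monoP[e3 [_ J3]].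
have f1 : hub_pot x1 <= 1.
  have [|/andP[_]|] := @hub_pot_near yv x1; first by exists e1.
    by rewrite /= eqxx; have [-> _ _] := f_spread a.
  by case=> -[].
have f2 : l.-1 <= hub_pot x2.
  have [|/andP[_]|] := @hub_pot_near x2 zv; first by exists e3.
    by rewrite /= !eqxx; lia.
  by case=> -[->] //= _; rewrite !eqxx.
have [|/andP[_ h]|] := @hub_pot_near x1 x2; first by exists e2.
  by lia.
by case=> -[E1 E2]; move: f1; rewrite E1 /= ?eqxx; lia.
Qed.

End Critical.
End CycleForcing.

Section CycleForcingExists.
Variables (q1 q l t : nat).
Hypotheses (l4 : 3 < l) (t3 : 2 < t) (q10 : 0 < q1) (q1q : q1 <= q).

Lemma cycle_forcing_exists : exists (D : mgraph) (d : et D),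
  @forcing q1 q l t (fun c : 'I_q => c < q1) D d.
Proof.
have l3 : 2 < l := ltnW l4.
have q0 : 0 < q := leq_trans q10 q1q.
have [B [r [B_col B_root]]] := rooted_block q1 l3 t3 q0.
have [C [Y [y [y_inj C_col C_spread C_conn]]]] := gadget_exists l3 t3 q10 q1q (l - 4).
have El : (l - 4).+2 = l - 2 by lia.
rewrite El in C_spread C_conn.
have {}C_conn := connects_some_every C_conn.
have [|V [A [inc [inc_inj inc_girth inc_mono]]]] :=
  @chromatic_girth_all 2 (vt B * Y)%type (vt B); first by apply/card_gt0P; exists r.
have [||S [[k a] [aS colS ncolS]]] :=
  @critical_set _ (fun S => colorable q1 q l t (hub_graph r y inc S)).
- exact: hub_colorable0.
- by apply: hub_not_colorable => //; eassumption.
(* Copies of [C] indexed by the root are never attached, so their identifications change nothing and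
   cannot be critical. *)
have kr : k.2 != r.
  apply/eqP => Ek; apply: ncolS; case: colS => phi fphi; exists phi.
  apply: good_sub fphi => i x x' /monoP[e [Ei J]]; apply/monoP; exists e; split=> //.
  have E c v : hub_io r y inc ((k, a) |: S) (a := c) v = hub_io r y inc S (a := c) v.
    case: c v => [j|k'] v //=; rewrite /hub_site; case: eqP => // nk'.
    rewrite (@eq_pick _ _ (fun b => (y b == v) && ((k', b) \in S))) // => b.
    rewrite in_setU1 xpair_eqE; case: (eqVneq k' k) => [Ek'|//].
    by rewrite Ek' in nk'.
  by move: J; rewrite /joins /= !E.
have [f Hf] := fin_all_exists C_spread.
have H : forall phi : et (hub_graph r y inc S) -> 'I_q, free q1 l t phi ->
    exists2 c : 'I_q, c < q1 & mono phi c None (Some (inl (inc k.1 (k.2, a), k.2))).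
  by apply: hub_forced => //; eassumption.
by have [//|d Hd] := forcing_cycle (G := hub_graph r y inc S) _ colS H; exists (hub_graph r y inc S), d.
Qed.

End CycleForcingExists.

(** * Gluing two pieces along two vertices *)

Lemma arc_lengths l a b : a.+1 + b.+1 = l -> 0 < a -> ~~ (l - 2 < b.+1).
Proof. by move=> <- a0; rewrite addSn addnS subSS subSS subn0 -leqNgt; lia. Qed.

Section TwoPieces.
Variables (q1 q l t : nat).
Hypotheses (l3 : 2 < l) (t3 : 2 < t).
Local Notation good := (@good q1 q l t _).
Variables (T : eqType) (R1 R2 : rel T) (V1 V2 : pred T) (x y : T).
Hypotheses (sup1 : forall a b, R1 a b -> V1 a && V1 b) (sup2 : forall a b, R2 a b -> V2 a && V2 b).
Hypothesis junction : forall a, V1 a -> V2 a -> (a == x) || (a == y).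
Hypothesis agree : forall a b, a != b -> V1 a -> V2 a -> V1 b -> V2 b -> R1 a b = R2 a b.

Let R : rel T := fun a b => R1 a b || R2 a b.

Lemma arc_one_side a p b : all (fun c => ~~ (V1 c && V2 c)) p -> path R a (rcons p b) ->
  path R1 a (rcons p b) \/ path R2 a (rcons p b).
Proof.
elim: p a => [|c p IHp] a /=.
  by move=> _; rewrite andbT => /orP[->|->]; [left|right].
case/andP=> nc np /andP[ac /(IHp _ np) pc].
have c1 : path R1 c (rcons p b) -> V1 c by case: (p) => [|? ?] /= /andP[/sup1/andP[]].
have c2 : path R2 c (rcons p b) -> V2 c by case: (p) => [|? ?] /= /andP[/sup2/andP[]].
case/orP: ac => ac; case: pc => pc; rewrite ?ac ?pc; auto.
  by have /andP[_ h] := sup1 ac; rewrite h c2 in nc.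
by have /andP[_ h] := sup2 ac; rewrite h c1 in nc.
Qed.

(** Two junctions cut the cycle into two arcs. If these lie on different sides, an arc of one edge
    moves to the other side by [agree]; otherwise the arc in [R2] has at least [l - 1] edges and the
    other at least 2, too many in total. Hence [R2] alone has to have long paths. *)
Lemma cycle_two_pieces :
  (forall a b p, V1 a -> V2 a -> V1 b -> V2 b -> path R2 a p -> last a p = b -> uniq (a :: p) ->
    1 < size p -> l - 2 < size p) ->
  has_cycle l R -> has_cycle l R1 \/ has_cycle l R2.
Proof.
move=> long [s [sz us cs]].
have [|/allPn[z zs]] := boolP (all (fun c => ~~ (V1 c && V2 c)) s).
  case: s sz us cs => [|a p] sz us cs; first by move: l3; rewrite -sz.
  case/andP=> _ np.
  by have [h|h] := arc_one_side np cs; [left|right]; exists (a :: p).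
rewrite negbK => /andP[z1 z2]; have [n p Ep] := rot_to zs.
have up : uniq (z :: p) by rewrite -Ep rot_uniq.
have cp : cycle R (z :: p) by rewrite -Ep rot_cycle.
have sp : size (z :: p) = l by rewrite -Ep size_rot.
have [np|/allPn[w wp]] := boolP (all (fun c => ~~ (V1 c && V2 c)) p).
  by have [h|h] := arc_one_side np cp; [left|right]; exists (z :: p).
rewrite negbK => /andP[w1 w2].
have zw : z != w by apply: contraTneq wp => <-; case/andP: up.
have only c : c != z -> c != w -> ~~ (V1 c && V2 c).
  move=> cz cw; apply/negP => /andP[/junction h /h].
  have := junction z1 z2; have := junction w1 w2.
  by case/orP=> /eqP E1 /orP[]/eqP E2 /orP[]/eqP E3;
     move: cz cw zw; rewrite ?E1 ?E2 ?E3 ?eqxx.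
case/splitPr: wp => p1 p2 in up cp sp *.
have [n1 n2] : all (fun c => ~~ (V1 c && V2 c)) p1 /\ all (fun c => ~~ (V1 c && V2 c)) p2.
  move: up; rewrite /= mem_cat inE !negb_or cat_uniq /= negb_or => /andP[/and3P[zp1 _ zp2]].
  case/and3P=> _ /andP[wp1 _] /andP[wp2 _].
  by split; apply/allP => c cp'; apply: only; apply: contraTneq cp' => ->.
move: cp; rewrite /= rcons_cat cat_path /= => /and3P[pa e pb].
have A1 : path R z (rcons p1 w) by rewrite rcons_path pa.
have [u1 u2] : uniq (z :: rcons p1 w) /\ uniq (w :: rcons p2 z).
  move: up; rewrite /= mem_cat inE !negb_or cat_uniq /= negb_or => /andP[/and3P[zp1 _ zp2]].
  case/and3P=> up1 /andP[wp1 _] /andP[wp2 up2].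
  by rewrite !mem_rcons !inE !negb_or !rcons_uniq zp1 zw wp1 up1 wp2 eq_sym zw zp2 up2.
have szl : (size p1).+1 + (size p2).+1 = l by rewrite -sp /= size_cat /= addSn.
have close (R0 : rel T) : path R0 z (rcons p1 w) -> path R0 w (rcons p2 z) -> has_cycle l R0.
  move=> h1 h2; exists (z :: p1 ++ w :: p2); split=> //.
  by move: h1; rewrite /= rcons_path rcons_cat cat_path /= => /andP[-> ->].
case: (arc_one_side n1 A1) => h1; case: (arc_one_side n2 pb) => h2.
- by left; apply: close.
- have [/size0nil E|s2] := posnP (size p2).
    by left; apply: close; rewrite // E /= andbT; move: h2; rewrite E /= andbT agree // eq_sym.
  have [/size0nil E|s1] := posnP (size p1).
    by right; apply: close; rewrite // E /= andbT; move: h1; rewrite E /= andbT agree.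
  have := long w z _ w1 w2 z1 z2 h2 (last_rcons _ _ _) u2.
  by rewrite size_rcons => /(_ s2) h; have := arc_lengths szl s1; rewrite h.
- have [/size0nil E|s2] := posnP (size p2).
    by right; apply: close; rewrite // E /= andbT; move: h2; rewrite E /= andbT agree // eq_sym.
  have [/size0nil E|s1] := posnP (size p1).
    by left; apply: close; rewrite // E /= andbT; move: h1; rewrite E /= andbT agree.
  have := long z w _ z1 z2 w1 w2 h1 (last_rcons _ _ _) u1.
  rewrite size_rcons => /(_ s1) h; rewrite addnC in szl.
  by have := arc_lengths szl s2; rewrite h.
- by right; apply: close.
Qed.

(** A clique vertex outside [V1] has all its edges in [R2], which puts the whole clique into
    [V2]. *)
Lemma clique_two_pieces : symmetric R1 -> symmetric R2 ->
  has_clique t R -> has_clique t R1 \/ has_clique t R2.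
Proof.
move=> sym1 sym2 [s [sz us cs]].
have P : {in s &, forall a b, a != b -> R a b}.
  by apply: pairwise_in cs => a b; rewrite /R sym1 sym2.
have [/allP a1|/allPn[a as_ na]] := boolP (all V1 s).
  left; exists s; split=> //; apply: in_pairwise => // a b as_ bs ab.
  case/orP: (P a b as_ bs ab) => // r2; have /andP[? ?] := sup2 r2.
  by rewrite agree // a1.
have a2 b : b \in s -> V2 b.
  move=> bs; have [->|ba] := eqVneq b a.
    have : size (rem a s) > 0 by rewrite size_rem // sz; case: (t) t3 => [|[]].
    case Er: (rem a s) => [//|c r] _.
    have : c \in rem a s by rewrite Er mem_head.
    rewrite mem_rem_uniq // inE => /andP[ca cs'].
    by rewrite eq_sym in ca; case/orP: (P a c as_ cs' ca) => [/sup1/andP[]|/sup2/andP[]] //; rewrite (negbTE na).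
  by rewrite eq_sym in ba; case/orP: (P a b as_ bs ba) => [/sup1/andP[]|/sup2/andP[]] //; rewrite (negbTE na).
right; exists s; split=> //; apply: in_pairwise => // b c bs cs' bc.
case/orP: (P b c bs cs' bc) => // r1; have /andP[? ?] := sup1 r1.
by rewrite -agree // a2.
Qed.

End TwoPieces.

(** * Forcing a clique colour *)

Lemma good_two_pieces (q1 q l t : nat) (T : eqType) (R1 R2 : 'I_q -> rel T) (V1 V2 : pred T) (x y : T) :
  2 < l -> 2 < t ->
  (forall i a b, R1 i a b -> V1 a && V1 b) -> (forall i a b, R2 i a b -> V2 a && V2 b) ->
  (forall a, V1 a -> V2 a -> (a == x) || (a == y)) ->
  (forall i a b, a != b -> V1 a -> V2 a -> V1 b -> V2 b -> R1 i a b = R2 i a b) ->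
  (forall i, symmetric (R1 i)) -> (forall i, symmetric (R2 i)) ->
  (forall i : 'I_q, i < q1 -> forall a b p, V1 a -> V2 a -> V1 b -> V2 b ->
    path (R2 i) a p -> last a p = b -> uniq (a :: p) -> 1 < size p -> l - 2 < size p) ->
  good q1 l t R1 -> good q1 l t R2 -> good q1 l t (fun i a b => R1 i a b || R2 i a b).
Proof.
move=> l3 t3 sup1 sup2 jun agr sym1 sym2 long g1 g2 i.
have := g1 i; have := g2 i; case: ifP => iq h2 h1 k.
  by case: (cycle_two_pieces l3 (sup1 i) (sup2 i) jun (agr i) (long i iq) k).
by case: (clique_two_pieces t3 (sup1 i) (sup2 i) (agr i) (sym1 i) (sym2 i) k).
Qed.

(** A path with at least two edges and no repeated vertex cannot use an edge between its own ends,
    and only there may [f] jump. *)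
Lemma near_path (T : eqType) (R : rel T) (f : T -> nat) x p :
  path R x p -> uniq (x :: p) -> 1 < size p ->
  (forall u v, R u v -> near (f u) (f v) \/
     ((u = x /\ v = last x p) \/ (u = last x p /\ v = x))) ->
  (f (last x p) <= f x + size p) && (f x <= f (last x p) + size p).
Proof.
case: p => [|a p] //= /andP[xa pa] /andP[xp up] p1 near_R.
have az : a != last a p.
  case: p p1 up {pa near_R xp} => //= b p _ /andP[ap _].
  by apply: contraNneq ap => ->; apply: mem_last.
have xz : x != last a p by apply: contraNneq xp => ->; apply: mem_last.
pose N u v := near (f u) (f v).
have n0 : N x a.
  by case: (near_R x a xa) => // -[[_ E]|[E _]]; [rewrite -E eqxx in az | rewrite -E eqxx in xz].
have np : path N a p.
  have ax : all (fun u => u != x) (a :: p).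
    by apply/allP => u ups; apply: contraNneq xp => <-.
  apply: (sub_in_path (P := fun u => u != x)) pa => // u v; rewrite !unfold_in => ux vx Ruv.
  by case: (near_R u v Ruv) => // -[[E _]|[_ E]]; [rewrite E eqxx in ux|rewrite E eqxx in vx].
have N1 u v : N u v -> f v <= (f u).+1 by case/andP.
have pN : path N x (a :: p) by rewrite /= n0.
apply/andP; split; first exact: path_potential N1 pN.
move: pN; rewrite -[(size p).+1]/(size (a :: p)) -[last a p]/(last x (a :: p)).
elim: (a :: p) x {xa xp xz n0 near_R} => [|b r IHr] u /=; first by rewrite addn0.
case/andP=> /andP[le _] /IHr le'; apply: leq_trans le _.
by rewrite addnS ltnS.
Qed.

Lemma near_gap l m : 3 < l -> near m 0 -> ~~ near m l.-1.
Proof. by rewrite /near; lia. Qed.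

Definition long_edge (l : nat) (G : mgraph) (d : et G) : Prop :=
  exists f : vt G -> nat, [/\ f (src d) = 0, f (tgt d) = l.-1
    & forall e, e = d \/ near (f (src e)) (f (tgt e))].

Definition edge_graph : mgraph := @MGraph bool unit (fun _ => false) (fun _ => true).

Section CliqueForcing.
Variables (q1 q l t : nat).
Hypotheses (l4 : 3 < l) (t3 : 2 < t) (l3 : 2 < l).
Local Notation free := (@free q1 q l t _).
Local Notation colorable := (@colorable q1 q l t).
Variables (D : mgraph) (d : et D).
Hypothesis D_forcing : @forcing q1 q l t (fun c : 'I_q => c < q1) D d.
Variables (C : mgraph) (Y : finType) (y : Y -> vt C).
Hypotheses (y_inj : injective y) (C_col : colorable C) (C_spread : spread (l - 2) y).
Hypothesis C_conn : @connects_some q1 q l t (l - 2) C Y y.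
Hypothesis q0 : 0 < q.

Local Notation W := (option (vt C + Y * vt D)).

Definition spoke_piece (c : option Y) : mgraph := if c is Some _ then D else C.

(** An unattached spoke is kept as a detached copy of [D], so that the edge type does not depend on
    the set of attached spokes. *)
Definition spoke_end (attached : bool) (a : Y) (v : vt D) : W :=
  if attached then
    if v == src d then None else if v == tgt d then Some (inl (y a)) else Some (inr (a, v))
  else Some (inr (a, v)).

Definition spoke_io (S : {set Y}) (c : option Y) : vt (spoke_piece c) -> W :=
  match c return vt (spoke_piece c) -> W with
  | None => fun w => Some (inl w)
  | Some a => spoke_end (a \in S) a
  end.

Definition spoke_graph S : mgraph := glue (spoke_io S).

Let dd : src d != tgt d. Proof. by case: D_forcing. Qed.

Lemma spoke_end_inj b a : injective (spoke_end b a).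
Proof.
move=> v v'; rewrite /spoke_end; case: b; last by case.
case: (v =P src d) => [->|_].
  by case: (v' =P src d) => [->//|_]; case: (v' == tgt d).
case: (v =P tgt d) => [->|_]; case: (v' =P src d) => [_|_] //; case: (v' =P tgt d) => [->|_] //.
by case.
Qed.

Lemma spoke_io_inj S c : injective (@spoke_io S c).
Proof. by case: c => [a|] /=; [exact: spoke_end_inj | move=> w w' []]. Qed.

Lemma spoke_colorable0 (c : 'I_q) : c < q1 -> colorable (spoke_graph set0).
Proof.
move=> cq; have [_ _ /(_ c cq)[phi fphi _]] := D_forcing.
apply: (colorable_glue l3 t3); [exact: spoke_io_inj | idtac | by case=> // a; exists phi].
apply: (no_short_cycle_hom (h := id) (io := fun v : void => match v with end) (V' := fun _ _ => true)) => //.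
  move=> a b x ab /existsP[v /eqP] + /existsP[v' /eqP].
  case: a b v v' ab => [a|] [b|] v v' ab /=; rewrite /spoke_end ?in_set0.
  - by move=> <- [E _]; rewrite E eqxx in ab.
  - by move=> <-.
  - by move=> <-.
  - by rewrite eqxx in ab.
by case=> [|[[]]].
Qed.

(** The spokes prescribe a cycle colour at every terminal; [connects_some] returns two spokes of one
    colour and a path of length [l - 2] in that colour between them. *)
Lemma spoke_not_colorable : ~ colorable (spoke_graph setT).
Proof.
case=> phi fphi.
have fD a := free_on_piece (a := Some a) (@spoke_io_inj setT (Some a)) fphi.
have sq a : (on_piece phi (a := Some a)) d < q1 by have [_ h _] := D_forcing; apply: h (fD a).
have fC := free_on_piece (a := None) (@spoke_io_inj setT None) fphi.
have [a [b [ab Es [p [pp lp sp up]]]]] := C_conn fC sq.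
rewrite /= in Es pp; set c : 'I_q := on_piece phi (a := Some a) d in Es pp.
have spoke x : on_piece phi (a := Some x) d = c -> mono phi c None (Some (inl (y x))).
  move=> Ex; have m : mono (on_piece phi (a := Some x)) c (src d) (tgt d).
    by apply/monoP; exists d; split=> //; apply/joinsP; left.
  have := mono_on_piece (io := spoke_io setT) (a := Some x) m.
  by rewrite /= /spoke_end in_setT eqxx [tgt d == _]eq_sym (negbTE dd) eqxx.
have := fphi c; rewrite sq; apply; exists (None :: map (fun w => Some (inl w)) (y a :: p)); split.
- by rewrite /= size_map sp; case: (l) l4 => [|[|k]] // _; rewrite subSS subSS subn0.
- rewrite cons_uniq map_inj_uniq ?up ?andbT; last by move=> u v [].
  by apply/negP => /mapP[].
rewrite /= spoke // rcons_path last_map lp mono_symmetric spoke // andbT path_map.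
by apply: sub_path pp => u v m; have := mono_on_piece (io := spoke_io setT) (a := None) m.
Qed.

Section Critical.
Variables (S : {set Y}) (a : Y).
Hypotheses (aS : a \notin S).

Definition chord_piece (c : option (option Y)) : mgraph :=
  if c is Some c' then spoke_piece c' else edge_graph.

Definition chord_io (c : option (option Y)) : vt (chord_piece c) -> W :=
  match c return vt (chord_piece c) -> W with
  | None => fun b : bool => if b then None else Some (inl (y a))
  | Some c' => @spoke_io S c'
  end.

Definition chord_graph : mgraph := glue chord_io.

Definition chord : et chord_graph := Tagged (fun c => et (chord_piece c)) (i := None) tt.

(** From [y a], the hub is reached only through another spoke, whose terminal already has potential
    [l - 2]; the spoke itself lies at [l - 1] apart from that terminal. *)
Lemma chord_potential : exists f : W -> nat,
  [/\ f (Some (inl (y a))) = 0, f None = l.-1 &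
   forall e : et chord_graph, e = chord \/ near (f (src e)) (f (tgt e))].
Proof.
have [f [f0 fe flip]] := C_spread a.
exists (fun x => match x with None => l.-1 | Some (inl w) => f w
   | Some (inr (b, _)) => if b \in S then l.-1 else 0 end); split=> //.
have El : l.-1 = (l - 2).+1 by case: (l) l4 => [|[|k]] // _; rewrite subSS subSS subn0.
case=> -[[b|]|] e; [right|right; exact: flip|by left; case: e].
rewrite /= /spoke_end; case bS: (b \in S); last by rewrite bS; exact: near_refl.
have Eb : f (y b) = l - 2 by apply: fe; apply: contraNneq aS => <-.
have N1 : near l.-1 (l - 2) by rewrite El near_sym /near leqnn leqW.
have N2 := near_refl l.-1.
have N3 := near_refl (l - 2).
have N4 : near (l - 2) l.-1 by rewrite near_sym.
by case: (src e == src d); case: (tgt e == src d); rewrite ?Eb //;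
   case: (src e == tgt d); case: (tgt e == tgt d); rewrite ?Eb ?bS.
Qed.

Lemma chord_long : long_edge l chord.
Proof. by have [f [f1 f2 f3]] := chord_potential; exists f. Qed.

(** A clique through the chord would contain a common neighbour of its ends, but their potentials 0
    and [l - 1] differ by more than 2. *)
Lemma chord_extend (phi : et (spoke_graph S) -> 'I_q) (c : 'I_q) : free phi -> q1 <= c ->
  exists2 psi : et chord_graph -> 'I_q, free psi & psi chord = c.
Proof.
move=> fphi cq.
pose psi (e : et chord_graph) : 'I_q := match e with
  | existT (Some x) ex => phi (Tagged (fun x => et (spoke_piece x)) ex)
  | existT None _ => c end.
exists psi => //; have [f [f0 f1 flip]] := chord_potential.
have old i x x' : mono psi i x x' -> mono phi i x x' \/
    i = c /\ (x = None /\ x' = Some (inl (y a)) \/ x = Some (inl (y a)) /\ x' = None).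
  case/monoP=> -[[x0|] e] [Ei /joinsP J].
    by left; apply/monoP; exists (Tagged (fun x => et (spoke_piece x)) e); split=> //; apply/joinsP.
  by right; split=> //; case: J => /= -[<- <-]; auto.
have lip i x x' : mono phi i x x' -> near (f x) (f x').
  case/monoP=> -[x0 e] [Ei J].
  have [//|h] := flip (Tagged (fun c => et (chord_piece c)) (i := Some x0) e).
  by case/joinsP: J => -[<- <-] //; rewrite near_sym.
move=> i; have := fphi i; case: ifP => iq H [s [sz us cs]]; apply: H.
  exists s; split=> //; apply: sub_cycle cs => x x' /old[//|[Ei _]].
  by rewrite Ei ltnNge cq in iq.
exists s; split=> //; apply: in_pairwise => // x x' xs x's xx'.
have P := pairwise_in (@mono_symmetric _ chord_graph psi i) cs.
case: (old _ _ _ (P x x' xs x's xx')) => // -[_ J].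
have [w [ws wx wx']] : exists w, [/\ w \in s, w != x & w != x'].
  have : 0 < size (rem x' (rem x s)).
    have x'r : x' \in rem x s by rewrite mem_rem_uniq // inE eq_sym xx'.
    by rewrite size_rem // size_rem // sz; case: (t) t3 => [|[|[]]].
  case Er: (rem _ _) => [//|w r] _; exists w.
  have : w \in rem x' (rem x s) by rewrite Er mem_head.
  by rewrite mem_rem_uniq ?rem_uniq // inE mem_rem_uniq // inE => /and3P[? ? ?]; split.
have wN : forall z, z \in s -> w != z -> (z = x \/ z = x') -> near (f w) (f z).
  move=> z zs wz Ez; case: (old _ _ _ (P w z ws zs wz)) => [/lip //|[_ J']].
  case: J wx wx' => -[-> ->] wx wx'; case: J' => -[E _]; move: wx wx'; by rewrite E ?eqxx.
have n1 := wN x xs wx (or_introl erefl); have n2 := wN x' x's wx' (or_intror erefl).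
by case: J n1 n2 => -[-> ->]; rewrite f0 f1 => n1 n2; have := near_gap l4; [move/(_ _ n2)/negP | move/(_ _ n1)/negP].
Qed.

(** If the chord had a cycle colour, a copy of [D] with that signal colour could replace it: all
    detours round the chord are long, so no [C_l] uses both sides, and the graph with the spoke [a]
    attached would be colourable. *)
Lemma chord_forced : ~ colorable (spoke_graph (a |: S)) ->
  forall psi : et chord_graph -> 'I_q, free psi -> q1 <= psi chord.
Proof.
move=> ncol psi fpsi; rewrite leqNgt; apply/negP => cq; apply: ncol.
have [_ _ /(_ _ cq)[phi0 fphi0 Ephi0]] := D_forcing.
set c := psi chord in cq Ephi0.
(* Edges parallel to [d] take its colour as well, so that both sides agree between the two
   junctions. *)
have [phi fphi [Ed Ephi]] : exists2 phi : et D -> 'I_q, free phi &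
    phi d = c /\ forall e, joins e (src d) (tgt d) -> phi e = c.
  exists (fun e => if joins e (src d) (tgt d) then phi0 d else phi0 e); first exact: free_recolor.
  by split=> [|e ->//]; case: ifP.
pose chi (e : et (spoke_graph (a |: S))) : 'I_q := match e with
  | existT (Some b) eb => if b == a then phi eb
      else psi (Tagged (fun c => et (chord_piece c)) (i := Some (Some b)) eb)
  | existT None e0 => psi (Tagged (fun c => et (chord_piece c)) (i := Some None) e0) end.
exists chi; have [f [f0 f1 flip]] := chord_potential.
pose pri (x : W) := if x is Some (inr (b, _)) then b == a else false.
pose R1 i : rel W := img (spoke_end true a) (mono phi i).
pose R2 i : rel W := fun x x' => [&& mono psi i x x', ~~ pri x & ~~ pri x'].
have sub i x x' : mono chi i x x' -> R1 i x x' || R2 i x x'.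
  case/monoP=> -[[b|] e] [Ei J]; last first.
    apply/orP; right; apply/and3P; split.
    - apply/monoP; exists (Tagged (fun c => et (chord_piece c)) (i := Some None) e).
      by split=> //; apply/joinsP; apply/joinsP: J.
    - by case/joinsP: J => /= -[E1 E2]; rewrite -?E1 -?E2.
    - by case/joinsP: J => /= -[E1 E2]; rewrite -?E1 -?E2.
  move: Ei; rewrite /chi; case: (eqVneq b a) => [Eb|ba] Ei.
    apply/orP; left; apply/imgP; case/joinsP: J => /= -[<- <-]; rewrite Eb setU11.
      by exists (src e), (tgt e); split=> //; apply/monoP; exists e; split=> //; apply/joinsP; left.
    by exists (tgt e), (src e); split=> //; apply/monoP; exists e; split=> //; apply/joinsP; right.
  apply/orP; right; have E : (b \in a |: S) = (b \in S) by rewrite in_setU1 (negbTE ba).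
  have np v : ~~ pri (spoke_end (b \in S) b v).
    by rewrite /spoke_end; case: ifP => _; [case: ifP => _ //; case: ifP => _ //|]; rewrite /= ba.
  apply/and3P; split.
  - apply/monoP; exists (Tagged (fun c => et (chord_piece c)) (i := Some (Some b)) e).
    by split=> //; apply/joinsP; case/joinsP: J => /= -[]; rewrite E; auto.
  - by case/joinsP: J => /= -[E1 E2]; rewrite -?E1 -?E2 E.
  - by case/joinsP: J => /= -[E1 E2]; rewrite -?E1 -?E2 E.
apply: (good_sub sub).
pose V1 x := [exists v, spoke_end true a v == x].
have R2_chord i : R2 i None (Some (inl (y a))) = (i == c).
  apply/and3P/eqP => [[/monoP[e [<- J]] _ _]|->].
    have [->//|h] := flip e; move: h; case/joinsP: J => /= -[-> ->].
      by rewrite f0 f1 /near; case: (l) l4 => [|[|[|k]]].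
    by rewrite f0 f1 /near; case: (l) l4 => [|[|[|k]]] // _; rewrite andbF.
  by split=> //; apply/monoP; exists chord; split=> //; apply/joinsP; right.
have R1_chord i : R1 i None (Some (inl (y a))) = (i == c).
  have E1 : spoke_end true a (src d) = None by rewrite /spoke_end eqxx.
  have E2 : spoke_end true a (tgt d) = Some (inl (y a)).
    by rewrite /spoke_end eq_sym (negbTE dd) eqxx.
  rewrite -E1 -E2; apply/idP/eqP => [/(img_inj (@spoke_end_inj true a))/monoP[e [<- J]]|->].
    exact: Ephi.
  by apply/imgP; exists (src d), (tgt d); split=> //; apply/monoP; exists d; split=> //; apply/joinsP; left.
have sym1 i : symmetric (R1 i) by apply: img_sym; apply: mono_symmetric.
have sym2 i : symmetric (R2 i) by move=> x x'; rewrite /R2 mono_symmetric; congr andb; rewrite andbC.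
have jun x : V1 x -> ~~ pri x -> (x == None) || (x == Some (inl (y a))).
  case/existsP=> v /eqP <-; rewrite /spoke_end; case: ifP => _; first by rewrite eqxx.
  by case: ifP => _ /=; rewrite ?eqxx // orbT.
apply: (good_two_pieces (V1 := V1) (V2 := fun x => ~~ pri x) l3 t3 _ _ jun) => //.
- by move=> i x x' /img_support.
- by move=> i x x' /and3P[_ -> ->].
- move=> i x x' xx' h1 h2 h3 h4.
  case/orP: (jun x h1 h2) xx' => /eqP ->; case/orP: (jun x' h3 h4) => /eqP ->; rewrite ?eqxx // => _.
    by rewrite R1_chord R2_chord.
  by rewrite sym1 sym2 R1_chord R2_chord.
- move=> i iq x x' p h1 h2 h3 h4 pp lp up p1.
  have xx' : x != x'.
    by case: p pp lp up p1 => //= b p _ <- /andP[xp _] _; apply: contraNneq xp => {1}->; apply: mem_last.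
  have [|le1 le2] := andP (near_path (f := f) pp up p1 _).
    move=> u v /and3P[/monoP[e [_ J]] _ _]; rewrite lp.
    have [Ee|h] := flip e; last by left; case/joinsP: J => -[<- <-] //; rewrite near_sym.
    right; move: J; rewrite Ee => /joinsP /= J.
    case/orP: (jun x h1 h2) xx' => /eqP ->; case/orP: (jun x' h3 h4) => /eqP ->; rewrite ?eqxx // => _.
      by case: J => -[-> ->]; auto.
    by case: J => -[-> ->]; auto.
  rewrite lp in le1 le2.
  have : l.-1 <= size p.
    case/orP: (jun x h1 h2) xx' le1 le2 => /eqP ->; case/orP: (jun x' h3 h4) => /eqP ->;
      by rewrite ?eqxx // f0 f1 ?add0n.
  by case: (l) l4 => [|[|k]] // _; rewrite subSS subSS subn0.
- by apply: good_img => //; exact: spoke_end_inj.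
by apply: good_sub fpsi => i x x' /and3P[].
Qed.

End Critical.
End CliqueForcing.

Section CliqueForcingExists.
Variables (q1 q l t : nat).
Hypotheses (l4 : 3 < l) (t3 : 2 < t) (q10 : 0 < q1) (q1q : q1 <= q).

Lemma clique_forcing_exists : exists (K : mgraph) (d : et K),
  @forcing q1 q l t (fun c : 'I_q => q1 <= c) K d /\ long_edge l d.
Proof.
have l3 : 2 < l := ltnW l4.
have q0 : 0 < q := leq_trans q10 q1q.
have [D [d D_forcing]] := cycle_forcing_exists l4 t3 q10 q1q.
have [C [Y [y [y_inj C_col C_spread C_conn]]]] := gadget_exists l3 t3 q10 q1q (l - 4).
have El : (l - 4).+2 = l - 2 by lia.
rewrite El in C_spread C_conn.
have [||S [a [aS [phi fphi] ncolS]]] :=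
  @critical_set _ (fun S => colorable q1 q l t (spoke_graph d y S)).
- by apply: (@spoke_colorable0 _ _ _ _ _ _ _ _ _ _ _ _ _ (Ordinal q0)); eassumption.
- by apply: spoke_not_colorable; eassumption.
exists (chord_graph d y S a), (chord d y S a); split; last by apply: chord_long; eassumption.
split=> //.
  by apply: chord_forced; eassumption.
by move=> c cq; apply: chord_extend; eassumption.
Qed.

End CliqueForcingExists.

(** * Attaching a graph along a safe edge *)

Section Safe.
Variables (q1 q l t : nat).
Hypotheses (l3 : 2 < l) (t3 : 2 < t).
Local Notation good := (@good q1 q l t _).
Local Notation free := (@free q1 q l t _).

Lemma good_hom_neq (T U : eqType) (f : T -> U) (R : 'I_q -> rel T) (R' : 'I_q -> rel U) :
  injective f -> (forall i x y, x != y -> R i x y -> R' i (f x) (f y)) -> good R' -> good R.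
Proof.
move=> inj sub gR'.
suff gN : good (fun i x y => (x != y) && R i x y).
  move=> i; have := gN i; case: ifP => _ H [s [sz us cs]]; apply: H; exists s; split=> //.
    apply: cycle_from_next => // x xs; rewrite (next_cycle cs xs) andbT eq_sym next_neq // sz.
    exact: ltnW.
  by move: us; rewrite uniq_pairwise => us; rewrite pairwise_relI us.
by apply: good_hom inj _ gR' => i x y /andP[]; apply: sub.
Qed.

(* The potential f certifies that every path of colour i between the ends of d, other
   than d itself, has length at least l - 1. *)
Definition edge_safe (G : mgraph) (phi : et G -> 'I_q) (d : et G) : Prop :=
  forall i : 'I_q, i < q1 -> exists f : vt G -> nat,
    [/\ f (src d) = 0, f (tgt d) = l.-1
      & forall a b, mono phi i a b -> near (f a) (f b) \/ joins d a b].

Lemma long_edge_safe (G : mgraph) (phi : et G -> 'I_q) (d : et G) :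
  long_edge l d -> edge_safe phi d.
Proof.
case=> f [f0 f1 flip] i _; exists f; split=> // a b /monoP[e [_ J]].
case: (flip e) => [<-|h]; [by right | left].
by case/joinsP: J => -[<- <-] //; rewrite near_sym.
Qed.

Lemma edge_safe_path (G : mgraph) (phi : et G -> 'I_q) (d : et G) (i : 'I_q) a b p :
  src d != tgt d -> edge_safe phi d -> i < q1 ->
  (a == src d) || (a == tgt d) -> (b == src d) || (b == tgt d) ->
  path (mono phi i) a p -> last a p = b -> uniq (a :: p) -> 1 < size p -> l - 2 < size p.
Proof.
move=> dd safe iq ja jb pp lp up p1; have [f [f0 f1 flip]] := safe i iq.
have ab : a != b.
  by case: p pp lp up p1 => //= c p _ <- /andP[ap _] _; apply: contraNneq ap => {1}->; apply: mem_last.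
have [|le1 le2] := andP (near_path (f := f) pp up p1 _).
  move=> u v /flip[h|/joinsP J]; [by left | right; rewrite lp].
  move: ja jb ab => /orP[]/eqP -> /orP[]/eqP ->; rewrite ?eqxx // => _.
    by case: J => -[-> ->]; auto.
  by case: J => -[-> ->]; auto.
rewrite lp in le1 le2.
have : l.-1 <= size p.
  move: ja jb ab le1 le2 => /orP[]/eqP -> /orP[]/eqP ->; by rewrite ?eqxx // f0 f1 ?add0n.
by case: (l) l3 => [|[|k]] // _; rewrite subSS subSS subn0.
Qed.

Lemma path_img (T : finType) (U : eqType) (j : T -> U) (R : rel T) x p :
  injective j -> path (img j R) (j x) p -> exists2 p', p = map j p' & path R x p'.
Proof.
move=> j_inj; elim: p x => [|y p IHp] x /=; first by exists [::].
case/andP=> /imgP[u [v [Ruv /j_inj Ex Ey]]]; rewrite -Ey => /IHp[p' -> pp'].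
by exists (v :: p') => //=; rewrite pp' -Ex Ruv.
Qed.

(** No length condition is imposed on [R]: a path of [G] between the ends of [d], other than a
    single edge, already has at least [l - 1] edges, and an arc of at least two edges in [R] makes
    the cycle too long. *)
Lemma good_attach (U : eqType) (R : 'I_q -> rel U) (V : pred U)
    (G : mgraph) (d : et G) (phi : et G -> 'I_q) (j : vt G -> U) :
  src d != tgt d -> free phi -> edge_safe phi d -> injective j ->
  (forall i, symmetric (R i)) -> (forall i a b, R i a b -> V a && V b) ->
  (forall v, V (j v) -> (v == src d) || (v == tgt d)) ->
  (V (j (src d)) -> V (j (tgt d)) ->
     forall i, R i (j (src d)) (j (tgt d)) = mono phi i (src d) (tgt d)) ->
  good R -> good (fun i a b => R i a b || img j (mono phi i) a b).
Proof.
move=> dd fphi safe j_inj R_sym R_sup jun agr gR.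
pose V2 a := [exists v, j v == a].
have img_eq i u v : img j (mono phi i) (j u) (j v) = mono phi i u v.
  by apply/idP/idP => [/(img_inj j_inj)//|m]; apply/imgP; exists u, v.
apply: (@good_two_pieces _ _ _ _ _ _ _ V V2 (j (src d)) (j (tgt d))) => //.
- move=> i a b /imgP[u [v [_ <- <-]]].
  by apply/andP; split; apply/existsP; [exists u | exists v].
- by move=> a Va /existsP[v /eqP Ea]; move: Va; rewrite -Ea => /jun; rewrite !(inj_eq j_inj).
- move=> i a b ab Va /existsP[u /eqP Ea] Vb /existsP[v /eqP Eb].
  move: ab Va Vb; rewrite -Ea -Eb img_eq (inj_eq j_inj) => uv Vu Vv.
  move: (Vu) (Vv) uv (jun _ Vu) (jun _ Vv) => + + + /orP[]/eqP Eu /orP[]/eqP Ev; rewrite Eu Ev ?eqxx // => V1' V2' _.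
    exact: agr.
  by rewrite R_sym mono_symmetric; apply: agr.
- by move=> i; apply: img_sym; apply: mono_symmetric.
- move=> i iq a b p Va /existsP[u /eqP Ea] Vb /existsP[v /eqP Eb]; rewrite -Ea => pp.
  have [p' -> {}pp] := path_img j_inj pp.
  rewrite last_map -Eb => /j_inj lp; rewrite -map_cons (map_inj_uniq j_inj) size_map => up p1.
  by apply: edge_safe_path dd safe iq _ _ pp lp up p1; apply: jun; rewrite ?Ea ?Eb.
exact: good_img.
Qed.

Definition safe_forcing (X : pred 'I_q) (G : mgraph) (d : et G) : Prop :=
  [/\ src d != tgt d, forall phi : et G -> 'I_q, free phi -> X (phi d)
    & forall c, X c -> exists phi : et G -> 'I_q, [/\ free phi, phi d = c & edge_safe phi d]].

End Safe.

(** * Forcing a cycle colour safely *)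

Section SafeCycleForcing.
Variables (q1 q l t : nat).
Hypotheses (l3 : 2 < l) (t3 : 2 < t).
Local Notation good := (@good q1 q l t _).
Local Notation free := (@free q1 q l t _).
Variables (K : mgraph) (d : et K).
Hypothesis K_forcing : @forcing q1 q l t (fun c : 'I_q => q1 <= c) K d.
Hypothesis K_long : long_edge l d.
Variables (N : nat) (S : {set 'I_N * 'I_N}) (e0 : 'I_N * 'I_N).
Hypotheses (e0_lt : e0.1 < e0.2) (e0S : e0 \notin S).

Local Notation E := ('I_N * 'I_N)%type.
Local Notation W := ('I_N + E * vt K)%type.

Definition live (e : E) : bool := (e.1 < e.2) && (e \in S).

Definition panel_piece (c : option E) : mgraph := if c is Some _ then K else edge_graph.

Definition panel_end (e : E) (v : vt K) : W :=
  if live e then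
    if v == src d then inl e.1 else if v == tgt d then inl e.2 else inr (e, v)
  else inr (e, v).

Definition panel_io (c : option E) : vt (panel_piece c) -> W :=
  match c return vt (panel_piece c) -> W with
  | None => fun b : bool => inl (if b then e0.2 else e0.1)
  | Some e => panel_end e
  end.

Definition panel_graph : mgraph := glue panel_io.

Definition panel_edge : et panel_graph := Tagged (fun c => et (panel_piece c)) (i := None) tt.

Let dd : src d != tgt d. Proof. by case: K_forcing. Qed.

Lemma panel_end_src e : live e -> panel_end e (src d) = inl e.1.
Proof. by rewrite /panel_end eqxx => ->. Qed.

Lemma panel_end_tgt e : live e -> panel_end e (tgt d) = inl e.2.
Proof. by rewrite /panel_end eqxx eq_sym (negbTE dd) => ->. Qed.

Variant panel_end_spec (e : E) (v : vt K) : W -> Prop :=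
| PanelSrc of live e & v = src d : panel_end_spec e v (inl e.1)
| PanelTgt of live e & v = tgt d : panel_end_spec e v (inl e.2)
| PanelPrivate of (live e -> v != src d /\ v != tgt d) : panel_end_spec e v (inr (e, v)).

Lemma panel_endP e v : panel_end_spec e v (panel_end e v).
Proof.
rewrite /panel_end; case: ifP => [L|nL]; last by apply: PanelPrivate; rewrite nL.
case: eqP => [Ev|/eqP nv]; first exact: PanelSrc.
case: eqP => [Ev|/eqP nv']; first exact: PanelTgt.
exact: PanelPrivate.
Qed.

Lemma live_neq e : live e -> e.1 != e.2.
Proof. by case/andP=> lt _; apply/eqP => Ee; rewrite Ee ltnn in lt. Qed.

Lemma panel_end_inj e : injective (panel_end e).
Proof.
move=> v v'; case: panel_endP => [L -> | L -> | _]; case: panel_endP => [_ -> | _ -> | _] // [] //.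
- by move=> Ee; have := live_neq L; rewrite Ee eqxx.
- by move=> Ee; have := live_neq L; rewrite Ee eqxx.
Qed.

(** If the plain edge had a clique colour, the signal colours of the copies of [K] together with it
    would colour the critical graph with [e0] restored, using clique colours only. *)
Lemma panel_forced :
  (forall phi : et (subK (e0 |: S)) -> 'I_q, (forall e, q1 <= phi e) -> ~ free phi) ->
  forall phi : et panel_graph -> 'I_q, free phi -> phi panel_edge < q1.
Proof.
move=> crit phi fphi; rewrite ltnNge; apply/negP => ge.
pose chi (e : et (subK (e0 |: S))) : 'I_q :=
  if e == e0 then phi panel_edge else on_piece phi (a := Some e) d.
apply: (crit chi).
  move=> e; rewrite /chi; case: ifP => // _; have [_ H _] := K_forcing.
  by apply: H; apply: (free_on_piece (a := Some e)) fphi; exact: panel_end_inj.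
apply: (@good_hom_neq _ _ _ _ l3 _ _ (fun v => inl v : W)) fphi; first by move=> u v [].
move=> i u v uv /monoP[e []]; rewrite /chi; case: (eqVneq e e0) => [->|ne] Ei.
  rewrite /joins /= in_setU1 eqxx e0_lt /= => J; apply/monoP; exists panel_edge; split=> //.
move=> J; have L : live e.
  move: J; rewrite /joins /= in_setU1 (negbTE ne) /= /live; case: ifP => //= _.
  by case/orP=> /andP[/eqP E1 /eqP E2]; rewrite -E1 -E2 eqxx in uv.
have E2 : tgt (m := subK (e0 |: S)) e = e.2.
  by move: L; rewrite /live /= in_setU1 (negbTE ne) /= => ->.
have m : mono (on_piece phi (a := Some e)) i (src d) (tgt d).
  by apply/monoP; exists d; split=> //; apply/joinsP; left.
have := mono_on_piece (io := panel_io) (a := Some e) m; rewrite /= panel_end_src // panel_end_tgt //.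
by case/joinsP: J; rewrite E2 /= => -[<- <-] //; rewrite mono_symmetric.
Qed.

Lemma panel_extend (psi : et (subK S) -> 'I_q) (c : 'I_q) :
  free psi -> (forall e, q1 <= psi e) -> c < q1 ->
  exists phi : et panel_graph -> 'I_q, [/\ free phi, phi panel_edge = c & edge_safe q1 l phi panel_edge].
Proof.
move=> fpsi Ppsi cq.
have phi_exists (e : E) : exists phi : et K -> 'I_q,
    [/\ free phi, phi d = psi e & forall e', joins e' (src d) (tgt d) -> phi e' = psi e].
  have [_ _ /(_ _ (Ppsi e))[phi fphi Ephi]] := K_forcing.
  exists (fun e' => if joins e' (src d) (tgt d) then phi d else phi e'); split.
  - exact: free_recolor.
  - by case: ifP.
  - by move=> e' ->.
have [phi Hphi] := fin_all_exists phi_exists.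
pose chi (e : et panel_graph) : 'I_q := match e with
  | existT None _ => c
  | existT (Some e') x => phi e' x end.
exists chi; split=> //; last first.
  move=> i iq; have [f [f0 f1 flip]] := K_long.
  (* The potential is 0 at [e0.1] and [l - 1] at every other original vertex. A copy of [K] attached
     at [e0.1] interpolates by the potential of [K], reversed when its target is the end at
     [e0.1]. *)
  pose g (e : E) m := if e.1 == e0.1 then m else if e.2 == e0.1 then l.-1 - m else l.-1.
  pose F (x : W) := match x with
    | inl v => if v == e0.1 then 0 else l.-1
    | inr (e, v) => if live e then g e (f v) else 0 end.
  exists F; split=> /=.
  - by rewrite eqxx.
  - by rewrite ifN //; apply/eqP => Ee; move: e0_lt; rewrite Ee ltnn.
  have FE e v : F (panel_end e v) = if live e then g e (f v) else 0.
    rewrite /F /g; case: panel_endP => [L ->|L ->|_] //; rewrite L ?f0 ?f1 ?subn0 ?subnn.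
      by case: (e.1 == e0.1) => //; case: (e.2 == e0.1).
    have := live_neq L; case: (eqVneq e.1 e0.1) => [->|_ _].
      by rewrite eq_sym => /negbTE->.
    by case: (e.2 == e0.1).
  have near_g e m n : near m n -> near (g e m) (g e n).
    by rewrite /g /near; case: (e.1 == e0.1) => //; case: (e.2 == e0.1) => //; lia.
  move=> a b /monoP[[[e|] x] [Ei J]]; last by right; move: J; case: x {Ei}.
  (* The potential of [K] jumps only on the signal edge, which has a clique colour whereas [i] is a
     cycle colour. *)
  left; have nx : near (f (src x)) (f (tgt x)).
    case: (flip x) => // Ex; have [_ Ed _] := Hphi e.
    by have := Ppsi e; rewrite -Ed -Ex leqNgt; move: iq; rewrite -Ei /= => ->.
  have : near (F (panel_end e (src x))) (F (panel_end e (tgt x))).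
    by rewrite !FE; case: (live e) => //; apply: near_g.
  by case/joinsP: J => /= -[<- <-] //; rewrite near_sym.
(* The skeleton on the original vertices, to which the copies of [K] are attached one at a time. As
   [psi] uses clique colours, its only cycle-coloured edge is [e0], so it contains no [C_l]. *)
pose base (i : 'I_q) : rel W := fun x y => match x, y with
  | inl a, inl b => (a != b) && mono psi i a b ||
      (i == c) && ((a == e0.1) && (b == e0.2) || (a == e0.2) && (b == e0.1))
  | _, _ => false end.
pose Rs (r : seq E) i : rel W := fun x y =>
  base i x y || has (fun e => img (panel_end e) (mono (phi e) i) x y) r.
have base_sym i : symmetric (base i).
  move=> [a|x] [b|y] //=; rewrite eq_sym mono_symmetric; congr (_ || _ && _).
  by rewrite orbC ![(b == _) && _]andbC.
have Rs_sym r i : symmetric (Rs r i).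
  move=> x y; rewrite /Rs base_sym; congr orb; apply: eq_has => e.
  by apply: img_sym; apply: mono_symmetric.
have base_good : good base.
  move=> i; case: ifP => iq [s [sz us cs]].
    suff /(uniq_leq_size us) : {subset s <= [:: inl e0.1; inl e0.2 : W]}.
      by rewrite sz leqNgt l3.
    move=> x xs; have := next_cycle cs xs; case: x {xs} => // a; case: (next _ _) => //= b.
    case/orP=> [/andP[_ /monoP[e [Ei _]]]|/andP[_]].
      by have := Ppsi e; rewrite Ei leqNgt iq.
    by case/orP=> /andP[/eqP-> _]; rewrite !inE eqxx ?orbT.
  have := fpsi i; rewrite iq; apply.
  apply: (@has_clique_img _ _ _ (fun v => inl v : W)); [exact: ltnW | by move=> u v [] | exists s; split=> //].
  apply: sub_pairwise cs => -[a|//] [b|//] /= /orP[/andP[_ m]|/andP[/eqP Ei _]].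
    by apply/imgP; exists a, b.
  by rewrite Ei cq in iq.
have live_ends e e' : live e -> live e' -> [|| (e.1 == e'.1) && (e.2 == e'.2) | (e.1 == e'.2) && (e.2 == e'.1)] -> e = e'.
  move=> /andP[lt _] /andP[lt' _]; case/orP=> /andP[/eqP E1 /eqP E2].
    by rewrite [e]surjective_pairing [e']surjective_pairing E1 E2.
  by move: lt; rewrite E1 E2 ltnNge ltnW.
have base_ends e i : live e -> base i (inl e.1) (inl e.2) = (i == psi e).
  move=> L; rewrite /= live_neq //=; case: (boolP (i == psi e)) => [/eqP->|ni].
    apply/orP; left; apply/monoP; exists e; split=> //; apply/joinsP; left.
    by move: L; rewrite /live /= => ->.
  apply/negbTE; rewrite negb_or; apply/andP; split; last first.
    case/andP: L => lt eS; apply/negP => /andP[_ /orP[]/andP[/eqP E1 /eqP E2]].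
      by move: eS; rewrite [e]surjective_pairing E1 E2 -surjective_pairing (negbTE e0S).
    by move: lt; rewrite E1 E2 ltnNge ltnW.
  apply: contra ni => /monoP[e' [<- /joinsP /= J]]; apply/eqP; congr psi; apply/esym.
  have L' : live e'.
    rewrite /live; case: ifP J => // _ J; case/eqP: (live_neq L).
    by case: J => -[<- <-].
  move: J; rewrite -/(live e') L' => J; apply: live_ends => //.
  by case: J => -[-> ->]; rewrite !eqxx ?orbT.
have Rs_good r : uniq r -> good (Rs r).
  elim: r => [_|e r IHr /= /andP[er ur]].
    by apply: good_sub base_good => i x y; rewrite /Rs /= orbF.
  have [fe Ed Ej] := Hphi e.
  (* All vertices except those private to the copy being attached. *)
  pose V (x : W) := if x is inr (e', _) then e' != e else true.
  apply: (@good_sub _ _ _ _ _ _ (fun i x y => Rs r i x y || img (panel_end e) (mono (phi e) i) x y)).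
    by move=> i x y; rewrite /Rs /= => /or3P[->|->|->]; rewrite ?orbT.
  have panel_on e' i x y : img (panel_end e') (mono (phi e') i) x y ->
      (exists v, panel_end e' v = x) /\ (exists v, panel_end e' v = y).
    by case/imgP=> u [v [_ <- <-]]; split; [exists u | exists v].
  apply: (good_attach l3 t3 (V := V) dd fe _ (@panel_end_inj e)) => //.
  - exact: long_edge_safe.
  - have V_panel e' v : e' \in r -> V (panel_end e' v).
      move=> e'r; case: panel_endP => //= _; apply: contraNneq er => <-; exact: e'r.
    move=> i x y /orP[|/hasP[e' e'r /panel_on[[u <-] [v <-]]]]; last by rewrite !V_panel.
    by case: x y => [a|a] [b|b].
  - move=> v; case: panel_endP => [_ -> _|_ -> _|_ /=]; rewrite ?eqxx ?orbT //.
  - move=> V1 _ i; have L : live e.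
      by apply/negPn/negP => nL; move: V1; rewrite /panel_end (negbTE nL) /= eqxx.
    rewrite panel_end_src // panel_end_tgt // /Rs base_ends //.
    have -> : has (fun e' => img (panel_end e') (mono (phi e') i) (inl e.1) (inl e.2)) r = false.
      apply/hasP => -[e' e'r /panel_on[[u Eu] [v Ev]]]; case/negP: er; rewrite (_ : e = e') //.
      have ne := live_neq L.
      case: (panel_endP e' u) Eu => // L' _ [Eu]; case: (panel_endP e' v) Ev => // _ _ [Ev];
        apply: live_ends => //; rewrite -?Eu -?Ev ?eqxx ?orbT //.
      - by rewrite -Eu -Ev eqxx in ne.
      - by rewrite -Eu -Ev eqxx in ne.
    rewrite orbF; apply/eqP/monoP => [->|[x [<- /Ej->//]]].
    by exists d; split=> //; apply/joinsP; left.
  exact: IHr.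
apply: (good_sub (R' := Rs (enum {: E}))); last exact/Rs_good/enum_uniq.
move=> i x y /monoP[[[e|] z] [Ei J]]; apply/orP.
  right; apply/hasP; exists e; rewrite ?mem_enum //; apply/imgP.
  case/joinsP: J => /= -[<- <-].
    by exists (src z), (tgt z); split=> //; apply/monoP; exists z; split=> //; apply/joinsP; left.
  by exists (tgt z), (src z); split=> //; apply/monoP; exists z; split=> //; apply/joinsP; right.
left; case/joinsP: J => /= -[<- <-]; rewrite -Ei /= !eqxx ?orbT //.
Qed.

End SafeCycleForcing.

Section SafeForcing.
Variables (q1 q l t : nat).
Hypotheses (l4 : 3 < l) (t3 : 2 < t) (q10 : 0 < q1) (q1q : q1 < q).

Lemma safe_clique_forcing : exists (G : mgraph) (d : et G),
  @safe_forcing q1 q l t (fun c : 'I_q => q1 <= c) G d.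
Proof.
have [K [d [[dd H1 H2] long]]] := clique_forcing_exists l4 t3 q10 (ltnW q1q).
exists K, d; split=> // c /H2[phi fphi Ephi]; exists phi; split=> //.
exact: long_edge_safe.
Qed.

Lemma safe_cycle_forcing : exists (G : mgraph) (d : et G),
  @safe_forcing q1 q l t (fun c : 'I_q => c < q1) G d.
Proof.
have l3 : 2 < l := ltnW l4.
have [K [d [Kf long]]] := clique_forcing_exists l4 t3 q10 (ltnW q1q).
have [|N [S [e0 [e0_lt e0S [psi fpsi Ppsi] crit]]]] :=
  @critical_graph q1 q l t l3 t3 (fun c : 'I_q => q1 <= c) (Ordinal q1q); first exact: leqnn.
exists (panel_graph d S e0), (panel_edge d S e0); split.
- by apply/eqP => -[E]; rewrite E ltnn in e0_lt.
- by apply: panel_forced; eassumption.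
by move=> c cq; apply: panel_extend; eassumption.
Qed.

End SafeForcing.

(** * Simple graphs *)

Local Open Scope fset_scope.

Lemma cycle_nthP (T : eqType) (x0 : T) (R : rel T) s : 0 < size s ->
  reflect (forall i, i < size s -> R (nth x0 s i) (nth x0 s (i.+1 %% size s))) (cycle R s).
Proof.
case: s => // x p _.
have E i : i < size (x :: p) -> nth x0 (x :: rcons p x) i = nth x0 (x :: p) i /\
    nth x0 (rcons p x) i = nth x0 (x :: p) (i.+1 %% size (x :: p)).
  move=> /= ip; rewrite -rcons_cons nth_rcons /= ip nth_rcons; split=> //.
  case: (ltngtP i (size p)) ip => [lt _|gt|-> _]; first by rewrite modn_small.
    by rewrite ltnS leqNgt gt.
  by rewrite modnn.
apply: (iffP (pathP x0)); rewrite size_rcons => H i ip; have := H i ip; have [E1 E2] := E i ip.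
  by rewrite E1 E2.
by rewrite E1 E2.
Qed.

Lemma fset2C (a b : nat) : [fset a; b] = [fset b; a].
Proof. by apply/fsetP => x; rewrite !inE orbC. Qed.

Lemma fset2_inj (a b c d : nat) : [fset a; b] = [fset c; d] ->
  (a = c /\ b = d) \/ (a = d /\ b = c).
Proof.
move=> /fsetP E; have := E a; have := E b; have := E c; have := E d.
rewrite !inE !eqxx ?orbT /=.
by do 4 (move=> h; move: h; (do ?case: eqP => ?)); subst; auto.
Qed.

Lemma imfset2 (f : nat -> nat) a b : [fset f x | x in [fset a; b]] = [fset f a; f b].
Proof.
apply/fsetP => y; rewrite !inE; apply/imfsetP/orP => [[x /=]|].
  by rewrite !inE => /orP[]/eqP -> ->; rewrite eqxx; auto.
by case=> /eqP ->; [exists a | exists b]; rewrite //= !inE eqxx ?orbT.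
Qed.

Definition adj (F : graph) : rel nat := fun a b => [fset a; b] \in edges F.

Lemma adj_sym F : symmetric (adj F).
Proof. by move=> a b; rewrite /adj fset2C. Qed.

Lemma adj_verts F a b : adj F a b -> (a \in verts F) && (b \in verts F).
Proof.
move=> /graphP[/fsubsetP sub _]; by rewrite !sub // !inE eqxx ?orbT.
Qed.

Lemma adj_neq F a b : adj F a b -> a != b.
Proof. by move=> /graphP[_]; rewrite cardfs2; case: eqP. Qed.

Lemma rel_graphP (V : {fset nat}) (r : rel nat) e : reflect
  (exists a b, [/\ e = [fset a; b], a \in V, b \in V, a != b & r a b]) (e \in edges (rel_graph V r)).
Proof.
apply: (iffP idP) => [/imfsetP[[a b] /=]|[a [b [-> aV bV ab rab]]]].
  by rewrite !inE /= => /andP[/andP[? ?] /andP[? ?]] ->; exists a, b.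
by apply/imfsetP; exists (a, b) => //=; rewrite !inE /= aV bV ab.
Qed.

Lemma in_vertex_range n i : (i \in vertex_range n) = (i < n).
Proof. by apply/imfsetP/idP => [[j /=]|lt]; [|exists i => //=]; rewrite mem_iota add0n // => ? ->. Qed.

Lemma cycle_copy F l : 2 < l -> contains_copy F (cycle_graph l) <-> has_cycle l (adj F).
Proof.
move=> l3; have l0 : 0 < l by apply: leq_trans l3.
split=> [[f [inj _ Hf]]|[s [sz us cs]]].
  exists (map f (iota 0 l)); split; first by rewrite size_map size_iota.
    rewrite map_inj_in_uniq ?iota_uniq // => i j; rewrite !mem_iota => /= hi hj.
    by apply: inj; rewrite in_vertex_range.
  apply/(cycle_nthP 0); rewrite size_map size_iota // => i il.
  have jl : i.+1 %% l < l by rewrite ltn_mod.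
  rewrite !(nth_map 0) ?size_iota // !nth_iota // !add0n /adj -imfset2; apply: Hf.
  apply/rel_graphP; exists i, (i.+1 %% l); rewrite !in_vertex_range; split=> //.
  case: (ltngtP i.+1 l) il => // [lt|Ei] _; first by rewrite modn_small // neq_ltn ltnSn.
  by rewrite Ei modnn; apply/eqP => E0; rewrite -Ei E0 in l3.
have cN := elimT (@cycle_nthP _ 0 (adj F) s _) cs; rewrite sz in cN.
exists (nth 0 s); split.
- move=> i j; rewrite !in_vertex_range => il jl /eqP; rewrite nth_uniq ?sz // => /eqP //.
- by move=> i; rewrite in_vertex_range => il; have /andP[] := adj_verts (cN l0 i il).
move=> e /rel_graphP[i [j [-> iV jV _ /eqP Ej]]]; rewrite imfset2 Ej; apply: cN => //.
by rewrite -in_vertex_range.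
Qed.

Lemma clique_copy F t : 1 < t -> contains_copy F (complete_graph t) <-> has_clique t (adj F).
Proof.
move=> t1; split=> [[f [inj _ Hf]]|[s [sz us cs]]].
  have us : uniq (map f (iota 0 t)).
    rewrite map_inj_in_uniq ?iota_uniq // => i j; rewrite !mem_iota => /= hi hj.
    by apply: inj; rewrite in_vertex_range.
  exists (map f (iota 0 t)); split; [by rewrite size_map size_iota | by [] |].
  apply: in_pairwise => // _ _ /mapP[i + ->] /mapP[j + ->]; rewrite !mem_iota => /= it jt ij.
  rewrite /adj -imfset2; apply: Hf; apply/rel_graphP; exists i, j; rewrite !in_vertex_range; split=> //.
  by apply: contraNneq ij => ->.
have P i j : i < t -> j < t -> i != j -> adj F (nth 0 s i) (nth 0 s j).
  by move=> it jt ij; apply: (pairwise_in (@adj_sym F) cs); rewrite ?mem_nth ?nth_uniq ?sz.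
exists (nth 0 s); split.
- by move=> i j; rewrite !in_vertex_range => il jl /eqP; rewrite nth_uniq ?sz // => /eqP.
- move=> i; rewrite in_vertex_range => it.
  have [j [jt ij]] : exists j, j < t /\ i != j.
    by case: (eqVneq i 0) => [->|i0]; [exists 1 | exists 0; split=> //; apply: ltnW].
  by have /andP[] := adj_verts (P i j it jt ij).
by move=> e /rel_graphP[i [j [-> iV jV ij _]]]; rewrite imfset2; apply: P; rewrite -?in_vertex_range.
Qed.

Section Conversion.
Variables (q1 q2 l t : nat).
Hypotheses (l3 : 2 < l) (t3 : 2 < t).
Local Notation q := (q1 + q2)%N.
Local Notation good := (@good q1 q l t _).
Local Notation free := (@free q1 q l t _).
Local Notation HT := (cycle_clique_tuple q1 q2 l t).

Lemma free_coloring_good F (psi : coloring q) :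
  free_coloring HT F psi <-> good (fun i => adj (color_graph F psi i)).
Proof.
have E i : contains_copy (color_graph F psi i) (HT i) <->
    (if i < q1 then has_cycle l (adj (color_graph F psi i)) else has_clique t (adj (color_graph F psi i))).
  by rewrite /cycle_clique_tuple; case: ifP => _; [apply: cycle_copy | apply: clique_copy; apply: ltnW].
split=> H i; have := H i; have := E i; case: ifP => _ [E1 E2] h k; apply: h; auto.
Qed.

Lemma adj_color F (psi : coloring q) i a b :
  adj (color_graph F psi i) a b = adj F a b && (psi [fset a; b] == i).
Proof. by rewrite /adj !inE. Qed.

Variables (G : mgraph) (d : et G).

Definition enc (v : vt G) : nat := enum_rank v.

Lemma enc_inj : injective enc.
Proof. by move=> u v /val_inj/enum_rank_inj. Qed.

Definition ends (e : et G) : {fset nat} := [fset enc (src e); enc (tgt e)].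

(** Loops vanish and parallel edges merge. A colouring [psi] pulls back to the multigraph as
    [psi \o ends], constant on parallel edges. *)
Definition simple_graph : graph :=
  rel_graph [fset enc v | v in enum (vt G)] (img enc (fun u v => [exists e, joins e u v])).

Lemma ends_joins e u v : ends e = [fset enc u; enc v] <-> joins e u v.
Proof.
split=> [/fset2_inj[] [/enc_inj E1 /enc_inj E2]|/joinsP[] [<- <-] //]; last by rewrite fset2C.
- by apply/joinsP; left.
- by apply/joinsP; right.
Qed.

Lemma in_verts v : enc v \in verts simple_graph.
Proof. by apply/imfsetP; exists v => //=; rewrite mem_enum. Qed.

Lemma simple_adj u v : adj simple_graph (enc u) (enc v) = (u != v) && [exists e, joins e u v].
Proof.
apply/idP/andP => [uv|[uv H]]; last first.
  apply/rel_graphP; exists (enc u), (enc v); rewrite !in_verts (inj_eq enc_inj); split=> //.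
  by apply/imgP; exists u, v.
have := adj_neq uv; rewrite (inj_eq enc_inj) => -> ; split=> //.
have /rel_graphP[a [b [E _ _ _ /imgP[u' [v' [/existsP[e J] Ea Eb]]]]]] := uv.
apply/existsP; exists e; apply/ends_joins; rewrite E -Ea -Eb; exact/ends_joins.
Qed.

Lemma simple_adjP a b : adj simple_graph a b -> exists u v, a = enc u /\ b = enc v.
Proof.
by case/adj_verts/andP=> /imfsetP[u _ ->] /imfsetP[v _ ->]; exists u, v.
Qed.

Lemma simple_color (psi : coloring q) i u v :
  adj (color_graph simple_graph psi i) (enc u) (enc v) = (u != v) && mono (psi \o ends) i u v.
Proof.
rewrite adj_color simple_adj -andbA; congr andb.
apply/andP/monoP => [[/existsP[e J] /eqP Ei]|[e [Ei J]]].
  by exists e; split=> //=; rewrite (proj2 (ends_joins e u v)).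
by split; [apply/existsP; exists e | rewrite -(proj2 (ends_joins e u v) J) -Ei].
Qed.

Lemma free_simple (psi : coloring q) :
  free_coloring HT simple_graph psi <-> free (psi \o ends).
Proof.
split=> [/free_coloring_good|] H.
  by apply: (@good_hom_neq _ _ _ _ l3 _ _ enc) H; [exact: enc_inj | move=> i u v uv m; rewrite simple_color uv].
apply/free_coloring_good; apply: good_sub (good_img t3 enc_inj H) => i a b ab.
have [|u [v [Ea Eb]]] := @simple_adjP a b; first by move: ab; rewrite adj_color => /andP[].
by move: ab; rewrite Ea Eb simple_color => /andP[_ m]; apply/imgP; exists u, v.
Qed.

Lemma simple_coloring (phi : et G -> 'I_q) : src d != tgt d -> free phi -> edge_safe q1 l phi d ->
  exists psi : coloring q,
    [/\ free (psi \o ends), psi (ends d) = phi d & edge_safe q1 l (psi \o ends) d].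
Proof.
move=> dd fphi safe.
(* One colour is kept among parallel edges, that of [d] between its ends. Colour classes only
   shrink, so freeness and the potentials persist; off the graph the value is arbitrary. *)
exists (fun s => if s == ends d then phi d
  else if [pick e | ends e == s] is Some e then phi e else phi d).
set psi := (X in [/\ free (X \o _), _ & _]).
have sub i u v : mono (psi \o ends) i u v -> mono phi i u v.
  case/monoP=> e [/= Ei J]; apply/monoP; move: Ei; rewrite /psi; case: eqP => [Ee|_].
    exists d; split=> //; apply/ends_joins; rewrite -Ee; exact/ends_joins.
  case: pickP => [e' /eqP Ee|/(_ e)]; last by rewrite eqxx.
  by exists e'; split=> //; apply/ends_joins; rewrite Ee; apply/ends_joins.
split; [exact: good_sub sub fphi | by rewrite /psi eqxx |].
by move=> i iq; have [f [f0 f1 flip]] := safe i iq; exists f; split=> // a b /sub/flip.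
Qed.

(** The proviso that [F] contains the signal edge as soon as it contains both its ends makes [F] and
    the gadget agree between the junctions, as [good_attach] requires. *)
Lemma simple_safe (psi : coloring q) : src d != tgt d -> free (psi \o ends) ->
  edge_safe q1 l (psi \o ends) d -> safe_at HT simple_graph [fset ends d] psi.
Proof.
move=> dd fpsi safe F junction joined psi' agree.
have Ed : ends d \in edges simple_graph.
  by rewrite -/(adj _ _ _) simple_adj dd; apply/existsP; exists d; apply/ends_joins.
have in_ends x : x \in endpoints [fset ends d] -> x \in ends d.
  by rewrite /endpoints big_seq_fset1.
rewrite !free_coloring_good; split=> H.
  apply: good_sub H => i a b; rewrite !adj_color => /andP[ab ->]; rewrite andbT.
  by rewrite /adj inE; apply/orP; right.
apply: (@good_sub _ _ _ _ _ _
   (fun i a b => adj (color_graph F psi' i) a b || img enc (mono (psi \o ends) i) a b)).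
  move=> i a b; rewrite !adj_color => /andP[]; rewrite {1}/adj inE => /orP[ab Ei|ab ->]; last first.
    by rewrite {1}/adj ab.
  have [u [v [Ea Eb]]] := simple_adjP ab; rewrite Ea Eb in ab Ei *.
  rewrite agree // in Ei; apply/orP; right; apply/imgP; exists u, v; split=> //.
  by have := simple_color psi i u v; rewrite adj_color /adj ab Ei => /esym/andP[].
apply: (good_attach l3 t3 (V := fun x => x \in verts F) dd fpsi safe enc_inj) => //.
- by move=> i; apply: adj_sym.
- by move=> i a b; rewrite adj_color => /andP[/adj_verts].
- move=> v vF; have /in_ends : enc v \in endpoints [fset ends d].
    by apply: (fsubsetP junction); rewrite inE in_verts.
  by rewrite /ends !inE !(inj_eq enc_inj).
- move=> sF tF i; rewrite adj_color.
  have -> : adj F (enc (src d)) (enc (tgt d)).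
    apply: joined; first by rewrite inE.
    by apply/fsubsetP => x; rewrite !inE => /orP[]/eqP ->.
  rewrite -/(ends d) agree //; apply/eqP/monoP => [<-|[e [<- /ends_joins J]]].
    by exists d; split=> //; apply/joinsP; left.
  by rewrite /= J.
Qed.

Lemma safe_determiner_simple (X : {set 'I_q}) (c0 : 'I_q) : c0 \in X ->
  @safe_forcing q1 q l t (fun c => c \in X) G d -> safe_determiner HT X simple_graph (ends d).
Proof.
move=> Xc0 [dd forced ex].
have ex' c : c \in X -> exists psi : coloring q,
    [/\ free_coloring HT simple_graph psi, psi (ends d) = c & safe_at HT simple_graph [fset ends d] psi].
  case/ex=> phi [fphi Ed safe]; have [psi [h1 h2 h3]] := simple_coloring dd fphi safe.
  by exists psi; split; [exact/free_simple | rewrite h2 | exact: simple_safe].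
split; last exact: ex'.
split.
- by rewrite -/(adj _ _ _) simple_adj dd; apply/existsP; exists d; apply/ends_joins.
- by have [psi [fpsi _ _]] := ex' c0 Xc0; exists psi.
- by move=> psi /free_simple/forced.
by move=> c /ex'[psi [fpsi Ed _]]; exists psi.
Qed.

End Conversion.

Local Close Scope fset_scope.

Theorem theorem2p8 (l t q1 q2 : nat)
    (hl : 4 <= l) (ht : 3 <= t) (hq1 : 1 <= q1) (hq2 : 1 <= q2) :
  (exists (D : graph) (d : {fset nat}),
      safe_determiner (cycle_clique_tuple q1 q2 l t)
        [set i : 'I_(q1 + q2) | i < q1] D d) /\
  (exists (D : graph) (d : {fset nat}),
      safe_determiner (cycle_clique_tuple q1 q2 l t)
        [set i : 'I_(q1 + q2) | q1 <= i] D d).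
Proof.
have q1q : (q1 < q1 + q2)%N by rewrite -[q1 in q1 < _]addn0 ltn_add2l.
have l3 : 2 < l := ltnW hl.
split.
  have [G [d [dd forced ex]]] := safe_cycle_forcing hl ht hq1 q1q.
  exists (simple_graph G), (ends d).
  apply: (safe_determiner_simple l3 ht (c0 := Ordinal (leq_trans hq1 (ltnW q1q)))); first by rewrite inE.
  by split=> // [phi /forced|c]; rewrite inE // => /ex.
have [G [d [dd forced ex]]] := safe_clique_forcing hl ht hq1 q1q.
exists (simple_graph G), (ends d).
apply: (safe_determiner_simple l3 ht (c0 := Ordinal q1q)); first by rewrite inE.
by split=> // [phi /forced|c]; rewrite inE // => /ex.
Qed.
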